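(* Assume $(\mathbf H_\Omega)$ and that, for all $\varepsilon>0$, the functions $b_1^\varepsilon,b_2^\varepsilon,l_1^\varepsilon,l_2^\varepsilon$ satisfy (C1)--(C3) (see context) with constants uniform in $\varepsilon$. Let $H_i^\varepsilon$ ($i=1,2$) and $H_T^\varepsilon$ be the Hamiltonians defined with these dynamics and costs, and let $\mathbb H^-_\varepsilon$ be the associated problem; let $\mathbb H^-$ be the problem associated with $(b_1,b_2)$ and $(l_1,l_2)$. Suppose that, as $\varepsilon\to0$, $(b_1^\varepsilon,b_2^\varepsilon,l_1^\varepsilon,l_2^\varepsilon)\to(b_1,b_2,l_1,l_2)$ locally uniformly (in the space variable, on $[0,T]$ and on the control sets: $b_i^\varepsilon\to b_i$ and $l_i^\varepsilon\to l_i$ uniformly on $K\times[0,T]\times A_i$ for every compact $K\subset\overline{\Omega_i}$) and $g^\varepsilon\to g$ locally uniformly in $\mathbb R^N$. Then the following holds. (i) If, for all $\varepsilon>0$, $v_\varepsilon$ is a lsc supersolution of $u_t+\mathbb H^-_\varepsilon(x,t,Du)=0$ in $\mathbb R^N\times(0,T)$, then $\underline v=\liminf_*v_\varepsilon$ is a lsc supersolution of $u_t+\mathbb H^-(x,t,Du)=0$ in $\mathbb R^N\times(0,T)$. (ii) If, for all $\varepsilon>0$, $u_\varepsilon$ is a usc subsolution of $u_t+\mathbb H^-_\varepsilon(x,t,Du)=0$ in $\mathbb R^N\times(0,T)$, and if $b_1,b_2$ satisfy (C4), then $\bar u=\limsup^*u_\varepsilon$ is a subsolution of $u_t+\mathbb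 H^-(x,t,Du)=0$ in $\mathbb R^N\times(0,T)$.
   Context: Geometry $(\mathbf H_\Omega)$: $\mathbb R^N=\Omega_1\cup\Omega_2\cup\mathcal H$, where $\Omega_1,\Omega_2$ are disjoint open sets and $\mathcal H=\partial\Omega_1=\partial\Omega_2$ is a $W^{2,\infty}$-hypersurface in $\mathbb R^N$. For $z\in\mathcal H$, $\mathbf n_i(z)$ is the unit normal to $\partial\Omega_i$ at $z$ pointing outwards $\Omega_i$. $T_z\mathcal H$ is the tangent space to $\mathcal H$ at $z$ and $D_{\mathcal H}$ is the gradient on $\mathcal H$. Control data: $T>0$, control sets $A_1,A_2$ (not depending on $\varepsilon$); for $i=1,2$, dynamics $b_i:\overline{\Omega_i}\times[0,T]\times A_i\to\mathbb R^N$ and running costs $l_i:\overline{\Omega_i}\times[0,T]\times A_i\to\mathbb R$ (and likewise $b_i^\varepsilon,l_i^\varepsilon$); $g,g^\varepsilon:\mathbb R^N\to\mathbb R$ are bounded continuous initial costs. (C1) $A_i$ is a compact metric space, $b_i$ is continuous, $|b_i|\le M_b$ and $|b_i(z,s,\alpha_i)-b_i(z',s',\alpha_i)|\le L_b(|z-z'|+|s-s'|)$. (C2) $l_i$ is uniformly continuous, $|l_i|\le M_l$, and $|l_i(z,s,\alpha_i)-l_i(z',s',\alpha_i)|\le m_l(|z-z'|+|s-s'|)$ for a modulus of continuity $m_l$. (C3) For all $z\in\overline{\Omega_i}$, $s\in[0,T]$, the set $\{(b_i(z,s,\alpha_i),l_i(z,s,\alpha_i)):\alpha_i\in A_i\}$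 is closed and convex. (C4) There is $\delta>0$ such that for $i=1,2$, $z\in\mathcal H$, $s\in[0,T]$: $\{b_i(z,s,\alpha_i)\cdot\mathbf n_i(z):\alpha_i\in A_i\}\supset[-\delta,\delta]$. ''Constants uniform in $\varepsilon$'' refers to $M_b,L_b,M_l,m_l$. Hamiltonians: $H_i(x,t,p)=\sup_{\alpha_i\in A_i}\{-b_i(x,t,\alpha_i)\cdot p-l_i(x,t,\alpha_i)\}$ for $x\in\overline{\Omega_i}$. With $a=(\alpha_1,\alpha_2,\mu)\in A_1\times A_2\times[0,1]$ and $z\in\mathcal H$: $b_{\mathcal H}(z,s,a)=\mu b_1(z,s,\alpha_1)+(1-\mu)b_2(z,s,\alpha_2)$, $l_{\mathcal H}(z,s,a)=\mu l_1(z,s,\alpha_1)+(1-\mu)l_2(z,s,\alpha_2)$, $A_0(z,s)=\{a: b_{\mathcal H}(z,s,a)\cdot\mathbf n_1(z)=0\}$, and for $p\in T_z\mathcal H$, $H_T(z,s,p)=\sup_{a\in A_0(z,s)}\{-b_{\mathcal H}(z,s,a)\cdot p-l_{\mathcal H}(z,s,a)\}$. $H_i^\varepsilon,H_T^\varepsilon$ are defined in the same way from $b_i^\varepsilon,l_i^\varepsilon$. Sub/supersolutions of $w_t+\mathbb H^-(x,t,Dw)=0$ in $\mathbb R^N\times(0,T)$: a bounded usc function $u$ is a subsolution if, in the viscosity sense, $u_t+H_i(x,t,Du)\le0$ in $\Omega_i\times(0,T)$ for $i=1,2$, $u_t+\min\{H_1(x,t,Du),H_2(x,t,Du)\}\le0$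 on $\mathcal H\times(0,T)$, and in addition $u_t+H_T(x,t,D_{\mathcal H}u)\le0$ on $\mathcal H\times[0,T]$, the latter meaning that for every $\phi\in C^1(\mathcal H\times[0,T])$ and every maximum point $(x,t)$ of $u|_{\mathcal H\times[0,T]}-\phi$ in $\mathcal H\times[0,T]$ one has $\phi_t(x,t)+H_T(x,t,D_{\mathcal H}\phi(x,t))\le0$. A bounded lsc function $v$ is a supersolution if, in the viscosity sense, $v_t+H_i(x,t,Dv)\ge0$ in $\Omega_i\times(0,T)$ for $i=1,2$ and $v_t+\max\{H_1(x,t,Dv),H_2(x,t,Dv)\}\ge0$ on $\mathcal H\times(0,T)$; no tangential condition is required of $v$. The notions for $\mathbb H^-_\varepsilon$ are the same with $H_i^\varepsilon,H_T^\varepsilon$. Half-relaxed limits: $\limsup^*u_\varepsilon(x,t)=\limsup_{(y,s)\to(x,t),\,\varepsilon\to0}u_\varepsilon(y,s)$, $\liminf_*v_\varepsilon(x,t)=\liminf_{(y,s)\to(x,t),\,\varepsilon\to0}v_\varepsilon(y,s)$.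
   Formalization: The half-relaxed limits are assumed to be bounded real functions (without this v_ε = -1/ε with zero costs is a counterexample); (ii) is asserted with the tangential inequality on H×[0,T] as written, and also on H×(0,T), since at t=0 it generally excludes all subsolutions. *)

(* Defs.v *)
From HB Require Import structures.
From mathcomp Require Import all_boot all_order all_algebra.
From mathcomp Require Import all_classical all_reals all_analysis.

Set Implicit Arguments.
Unset Strict Implicit.
Unset Printing Implicit Defensive.

Import Order.TTheory GRing.Theory Num.Theory.
Import numFieldNormedType.Exports.

Local Open Scope classical_set_scope.
Local Open Scope ring_scope.

(* The two sides i = 1, 2 are indexed by bool: true stands for 1, false for 2.
   R^N is 'rV[R]_N; its library norm is the sup norm, so Euclidean lengths are
   written with enorm.  Topology, compactness and differentiability are the
   same for both norms. *)

Section Euclidean.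
Context {R : realType} {N : nat}.
Local Notation V := 'rV[R]_N.

Definition dot (u v : V) : R := \sum_(j < N) u 0 j * v 0 j.

Definition enorm (u : V) : R := Num.sqrt (dot u u).

Definition grad (psi : V -> R) (z : V) : V :=
  \row_(j < N) 'D_(delta_mx 0 j : V) psi z.

End Euclidean.

Section Geometry.
Context {R : realType} {N : nat}.
Local Notation V := 'rV[R]_N.

Definition boundary (O : set V) : set V := closure O `\` interior O.

(* S is, in U, the zero set of a W^{2,oo} function (differentiable with
   Lipschitz gradient) without critical points. *)
Definition local_equation (S U : set V) (psi : V -> R) : Prop :=
  [/\ open U,
      forall y, U y -> differentiable psi y /\ grad psi y != 0,
      exists L : R, forall y y', U y -> U y' ->
        enorm (grad psi y - grad psi y') <= L * enorm (y - y')
    & forall y, U y -> (S y <-> psi y = 0)].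

Definition W2inf_hypersurface (S : set V) : Prop :=
  forall z, S z -> exists U psi, local_equation S U psi /\ U z.

Definition H_Omega (Omega : bool -> set V) (H : set V) : Prop :=
  [/\ forall i, open (Omega i),
      Omega true `&` Omega false = set0,
      [set: V] = Omega true `|` Omega false `|` H,
      forall i, H = boundary (Omega i)
    & W2inf_hypersurface H].

Definition outward_unit_normal (O : set V) (z n : V) : Prop :=
  exists U psi, [/\ local_equation (boundary O) U psi, U z,
    forall y, U y -> (O y <-> psi y < 0)
    & n = (enorm (grad psi z))^-1 *: grad psi z].

End Geometry.

Section ControlHypotheses.
Context {R : realType} {N : nat}.
Local Notation V := 'rV[R]_N.
Variables (Omega : bool -> set V) (H : set V) (n : bool -> V -> V) (T : R).
Variables (A : bool -> metricType R).
Variables (b : forall i, V -> R -> A i -> V) (l : forall i, V -> R -> A i -> R).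

Definition modulus (m : R -> R) : Prop :=
  (forall r, 0 <= r -> 0 <= m r) /\ m r @[r --> 0^'+] --> 0.

(* Dynamics and costs are total functions, constrained only on dom i. *)
Definition dom (i : bool) : set (V * R) :=
  [set q | closure (Omega i) q.1 /\ 0 <= q.2 <= T].

Definition C1 (Mb Lb : R) : Prop := forall i : bool,
  [/\ compact [set: A i],
      {within [set q : V * R * A i | dom i q.1],
        continuous (fun q => b q.1.1 q.1.2 q.2)},
      forall z s a, dom i (z, s) -> enorm (b z s (a : A i)) <= Mb
    & forall z z' s s' a, dom i (z, s) -> dom i (z', s') ->
        enorm (b z s (a : A i) - b z' s' a)
          <= Lb * (enorm (z - z') + `|s - s'|)].

Definition C2 (Ml : R) (ml : R -> R) : Prop := forall i : bool,
  [/\ forall e, 0 < e -> exists2 d, 0 < d &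
        forall z z' s s' (a a' : A i), dom i (z, s) -> dom i (z', s') ->
          enorm (z - z') < d -> `|s - s'| < d -> mdist a a' < d ->
          `|l z s a - l z' s' a'| < e,
      forall z s a, dom i (z, s) -> `|l z s (a : A i)| <= Ml
    & forall z z' s s' a, dom i (z, s) -> dom i (z', s') ->
        `|l z s (a : A i) - l z' s' a| <= ml (enorm (z - z') + `|s - s'|)].

Definition bl_set (i : bool) (z : V) (s : R) : set (V * R) :=
  [set (b z s a, l z s a) | a in [set: A i]].

Definition C3 : Prop := forall i z s, dom i (z, s) ->
  closed (bl_set i z s) /\ convex_set (bl_set i z s).

Definition C4 : Prop := exists2 delta : R, 0 < delta &
  forall i z s, H z -> 0 <= s <= T ->
    `[- delta, delta] `<=` [set dot (b z s a) (n i z) | a in [set: A i]].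

End ControlHypotheses.

Section Hamiltonians.
Context {R : realType} {N : nat}.
Local Notation V := 'rV[R]_N.
Variables (n : bool -> V -> V) (A : bool -> metricType R).
Variables (b : forall i, V -> R -> A i -> V) (l : forall i, V -> R -> A i -> R).

Definition Ham (i : bool) (x : V) (t : R) (p : V) : \bar R :=
  ereal_sup [set (- dot (b x t a) p - l x t a)%:E | a in [set: A i]].

Definition bH (z : V) (s : R) (a : A true * A false * R) : V :=
  a.2 *: b z s a.1.1 + (1 - a.2) *: b z s a.1.2.

Definition lH (z : V) (s : R) (a : A true * A false * R) : R :=
  a.2 * l z s a.1.1 + (1 - a.2) * l z s a.1.2.

Definition A0 (z : V) (s : R) : set (A true * A false * R) :=
  [set a | 0 <= a.2 <= 1 /\ dot (bH z s a) (n true z) = 0].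

(* Without (C4) the set A0 z s may be empty, and then HT z s p = -oo: this is
   why Hamiltonians take values in \bar R. *)
Definition HT (z : V) (s : R) (p : V) : \bar R :=
  ereal_sup [set (- dot (bH z s a) p - lH z s a)%:E | a in A0 z s].

End Hamiltonians.

Section Viscosity.
Context {R : realType} {N : nat}.
Local Notation V := 'rV[R]_N.

Definition C1fun (phi : V * R -> R) : Prop :=
  (forall p, differentiable phi p) /\ (forall v, continuous ('D_v phi)).

Definition Dx (phi : V * R -> R) (p : V * R) : V :=
  \row_(j < N) 'D_((delta_mx 0 j, 0) : V * R) phi p.

Definition Dt (phi : V * R -> R) (p : V * R) : R := 'D_((0, 1) : V * R) phi p.

(* Gradient on the hypersurface with unit normal nu, for the restriction of a
   C^1 function of the ambient space. *)
Definition DH (nu : V -> V) (phi : V * R -> R) (p : V * R) : V :=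
  Dx phi p - dot (Dx phi p) (nu p.1) *: nu p.1.

Definition QT (T : R) : set (V * R) := [set p | 0 <= p.2 <= T].

Definition bounded_on (D : set (V * R)) (u : V * R -> R) : Prop :=
  exists M : R, forall p, D p -> `|u p| <= M.

Definition usc_on (D : set (V * R)) (u : V * R -> R) : Prop :=
  forall p, D p -> forall e, 0 < e ->
    \forall q \near within D (nbhs p), u q < u p + e.

Definition lsc_on (D : set (V * R)) (u : V * R -> R) : Prop :=
  forall p, D p -> forall e, 0 < e ->
    \forall q \near within D (nbhs p), u p - e < u q.

Definition local_max (f : V * R -> R) (p : V * R) : Prop :=
  \forall q \near p, f q <= f p.

Definition local_min (f : V * R -> R) (p : V * R) : Prop :=
  \forall q \near p, f p <= f q.

Variables (Omega : bool -> set V) (H : set V) (n : bool -> V -> V) (T : R).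
Variables (A : bool -> metricType R).
Variables (b : forall i, V -> R -> A i -> V) (l : forall i, V -> R -> A i -> R).

Local Notation Hi i x t p := (Ham b l (i : bool) x t p).

(* u_t + H_T(x, t, D_H u) <= 0 on H x J.  The functions of C^1(H x J) are taken
   as restrictions of C^1 functions on R^N x R, H being a closed C^1
   submanifold.
   The set J of times is a parameter, to be `[0, T] or `]0, T[.  Beware of the
   closed interval: it imposes the inequality at t = 0 too, so the test
   functions C t + K |x - z|^2 with C large contradict it as soon as A0 is
   nonempty near some z in H.  The open interval is the usual condition, tested
   in the interior of the time interval only. *)
Definition tangential_subsolution (J : set R) (u : V * R -> R) : Prop :=
  forall phi, C1fun phi -> forall x t, H x -> J t ->
    (forall y s, H y -> J s -> u (y, s) - phi (y, s) <= u (x, t) - phi (x, t)) ->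
    ((Dt phi (x, t))%:E + HT n b l x t (DH (n true) phi (x, t)) <= 0)%E.

Definition subsolution (J : set R) (u : V * R -> R) : Prop :=
  [/\ bounded_on (QT T) u /\ usc_on (QT T) u,
      forall i phi, C1fun phi -> forall x t, Omega i x -> 0 < t < T ->
        local_max (u \- phi) (x, t) ->
        ((Dt phi (x, t))%:E + Hi i x t (Dx phi (x, t)) <= 0)%E,
      forall phi, C1fun phi -> forall x t, H x -> 0 < t < T ->
        local_max (u \- phi) (x, t) ->
        ((Dt phi (x, t))%:E + Order.min (Hi true x t (Dx phi (x, t)))
                                        (Hi false x t (Dx phi (x, t))) <= 0)%E
    & tangential_subsolution J u].

Definition supersolution (v : V * R -> R) : Prop :=
  [/\ bounded_on (QT T) v /\ lsc_on (QT T) v,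
      forall i phi, C1fun phi -> forall x t, Omega i x -> 0 < t < T ->
        local_min (v \- phi) (x, t) ->
        (0 <= (Dt phi (x, t))%:E + Hi i x t (Dx phi (x, t)))%E
    & forall phi, C1fun phi -> forall x t, H x -> 0 < t < T ->
        local_min (v \- phi) (x, t) ->
        (0 <= (Dt phi (x, t))%:E + Order.max (Hi true x t (Dx phi (x, t)))
                                             (Hi false x t (Dx phi (x, t))))%E].

End Viscosity.

Section HalfRelaxedLimits.
Context {R : realType} {N : nat}.
Local Notation V := 'rV[R]_N.

(* (eps, q) -> (0+, p) with q in R^N x [0, T] *)
Definition relaxed_filter (T : R) (p : V * R) : set_system (R * (V * R)) :=
  filter_prod 0^'+ (within (QT T) (nbhs p)).

Definition limsup_star (T : R) (u : R -> V * R -> R) (p : V * R) : \bar R :=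
  limf_esup (fun q : R * (V * R) => (u q.1 q.2)%:E) (relaxed_filter T p).

Definition liminf_star (T : R) (v : R -> V * R -> R) (p : V * R) : \bar R :=
  limf_einf (fun q : R * (V * R) => (v q.1 q.2)%:E) (relaxed_filter T p).

End HalfRelaxedLimits.

Section Convergence.
Context {R : realType} {N : nat}.
Local Notation V := 'rV[R]_N.

Definition loc_unif_cvg_dynamics (Omega : bool -> set V) (T : R)
    (A : bool -> metricType R)
    (be : R -> forall i, V -> R -> A i -> V) (b : forall i, V -> R -> A i -> V) :
    Prop :=
  forall i K, compact K -> K `<=` closure (Omega i) ->
  forall eta, 0 < eta -> \forall e \near 0^'+,
    forall z s (a : A i), K z -> 0 <= s <= T ->
      enorm (be e i z s a - b i z s a) < eta.

Definition loc_unif_cvg_costs (Omega : bool -> set V) (T : R)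
    (A : bool -> metricType R)
    (le : R -> forall i, V -> R -> A i -> R) (l : forall i, V -> R -> A i -> R) :
    Prop :=
  forall i K, compact K -> K `<=` closure (Omega i) ->
  forall eta, 0 < eta -> \forall e \near 0^'+,
    forall z s (a : A i), K z -> 0 <= s <= T ->
      `|le e i z s a - l i z s a| < eta.

Definition loc_unif_cvg (ge : R -> V -> R) (g : V -> R) : Prop :=
  forall K, compact K -> forall eta, 0 < eta -> \forall e \near 0^'+,
    forall x, K x -> `|ge e x - g x| < eta.

Definition bounded_continuous (g : V -> R) : Prop :=
  continuous g /\ exists M : R, forall x, `|g x| <= M.

End Convergence.

(* Main.v *)
(* The dynamics are Lipschitz and the costs equicontinuous uniformly
   in eps, so only convergence at the limit point matters: the expressions
   phi_t - b . D phi - l converge uniformly in the control, and the usual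
   half-relaxed-limits argument yields all inequalities but the tangential one.
   For the latter the limit is touched from above only along the interface, while
   it is a limit over all of space.  The interface being locally {psi = 0}, the
   penalty C |psi| brings the maxima of u_eps - phi - C |psi| back onto the
   interface: off it, (C4) provides a control pushing back towards the interface
   and the Hamiltonian of the penalized test function is of order C > 0.  On the
   interface, (C4) and the convexity (C3) turn a tangential control for the limit
   into nearby tangential controls for the perturbed problems.
   The closed time interval is a degenerate case: the tangential inequality at
   t = 0 then has no subsolution at all. *)
Require Import Defs.
From HB Require Import structures.
From mathcomp Require Import all_boot all_order all_algebra.
From mathcomp Require Import all_classical all_reals all_analysis.
From mathcomp Require Import ring lra.
Import Order.TTheory GRing.Theory Num.Theory.
Import numFieldNormedType.Exports.
Local Open Scope classical_set_scope.
Local Open Scope ring_scope.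

Set Implicit Arguments.
Unset Strict Implicit.
Unset Printing Implicit Defensive.

(** Hamiltonians may equal -oo and are never shown to be continuous. Each inequality is unfolded
    into real inequalities, one per control: a failure is a single control for subsolutions, and a
    uniform margin over all controls for supersolutions. Three obstacles shape the tangential limit.
    The maxima move with [C], so the neighborhood where the controls are good must be fixed before
    [C]: its constants involve only the unpenalized test function, and [C] is taken large against
    them. A test function must be C^1 on the whole space, whereas [|psi|] is known near one point
    only and has a kink on [H]: at a maximum off [H] it is replaced by its linearization plus a
    squared distance dominating the remainder, which the Lipschitz gradient permits. Finally, the
    tangential condition asks for a maximum over all of [H] and all times, while penalization gives
    a local one: a large quadratic term with zero gradient at the point makes it global, thanks to
    the boundedness of [u e] and [ubar]. *)

Section EuclideanSpace.
Context {R : realType} {N : nat}.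
Local Notation V := 'rV[R]_N.
Implicit Types u v w : V.

Lemma dotC u v : dot u v = dot v u.
Proof. by apply: eq_bigr => j _; rewrite mulrC. Qed.

Lemma dotDl u v w : dot (u + v) w = dot u w + dot v w.
Proof. by rewrite -big_split; apply: eq_bigr => j _; rewrite mxE mulrDl. Qed.

Lemma dotDr u v w : dot w (u + v) = dot w u + dot w v.
Proof. by rewrite dotC dotDl !(dotC _ w). Qed.

Lemma dotZl k u v : dot (k *: u) v = k * dot u v.
Proof. by rewrite mulr_sumr; apply: eq_bigr => j _; rewrite mxE mulrA. Qed.

Lemma dotZr k u v : dot u (k *: v) = k * dot u v.
Proof. by rewrite dotC dotZl dotC. Qed.

Lemma dotNl u v : dot (- u) v = - dot u v.
Proof. by rewrite -scaleN1r dotZl mulN1r. Qed.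

Lemma dotNr u v : dot u (- v) = - dot u v.
Proof. by rewrite dotC dotNl dotC. Qed.

Lemma dotBl u v w : dot (u - v) w = dot u w - dot v w.
Proof. by rewrite dotDl dotNl. Qed.

Lemma dotBr u v w : dot w (u - v) = dot w u - dot w v.
Proof. by rewrite dotDr dotNr. Qed.

Lemma dot0l u : dot 0 u = 0.
Proof. by rewrite -(scale0r u) dotZl mul0r. Qed.

Lemma dot0r u : dot u 0 = 0.
Proof. by rewrite dotC dot0l. Qed.

Lemma dot_ge0 u : 0 <= dot u u.
Proof. by apply: sumr_ge0 => j _; rewrite -expr2 sqr_ge0. Qed.

Lemma dot_gt0 u : u != 0 -> 0 < dot u u.
Proof.
move=> u0; rewrite lt_neqAle dot_ge0 andbT eq_sym.
apply: contra u0 => /eqP duu; apply/eqP/rowP => j; rewrite mxE.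
have /eqP : u 0 j * u 0 j = 0.
  apply: (psumr_eq0P (P := xpredT) (F := fun j => u 0 j * u 0 j)) => // k _.
  by rewrite -expr2 sqr_ge0.
by rewrite mulf_eq0 orbb => /eqP.
Qed.

Lemma enorm_ge0 u : 0 <= enorm u. Proof. exact: sqrtr_ge0. Qed.

Lemma sqr_enorm u : enorm u ^+ 2 = dot u u.
Proof. by rewrite sqr_sqrtr // dot_ge0. Qed.

Lemma enorm_gt0 u : u != 0 -> 0 < enorm u.
Proof. by move=> u0; rewrite sqrtr_gt0 dot_gt0. Qed.

(** Cauchy-Schwarz: the square of [dot v v *: u - dot u v *: v] expands to [dot v v] times the
    defect of the squared inequality. *)
Lemma dot_enorm u v : `|dot u v| <= enorm u * enorm v.
Proof.
have [->|v0] := eqVneq v 0.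
  by rewrite dot0r normr0 mulr_ge0 ?enorm_ge0.
have vv := dot_gt0 v0.
rewrite -sqrtrM ?dot_ge0 // -sqrtr_sqr ler_wsqrtr //.
have := dot_ge0 (dot v v *: u - dot u v *: v).
rewrite dotBl !dotBr !dotZl !dotZr (dotC v u).
set a := dot u u; set c := dot v v in vv *; set d := dot u v => h.
have {}h : 0 <= c * (a * c - d ^+ 2) by apply: le_trans h _; lra.
by rewrite pmulr_rge0 // subr_ge0 in h.
Qed.

Lemma ler_enormD u v : enorm (u + v) <= enorm u + enorm v.
Proof.
rewrite -(@ler_pXn2r _ 2) ?nnegrE ?addr_ge0 ?enorm_ge0 // sqr_enorm.
rewrite dotDl !dotDr -!sqr_enorm (dotC v u).
have := le_trans (ler_norm _) (dot_enorm u v).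
rewrite ?sqrrD; nra.
Qed.

Lemma enormN u : enorm (- u) = enorm u.
Proof. by rewrite /enorm dotNl dotNr opprK. Qed.

Lemma enormZ k u : enorm (k *: u) = `|k| * enorm u.
Proof. by rewrite /enorm dotZl dotZr mulrA -expr2 sqrtrM ?sqr_ge0 // sqrtr_sqr. Qed.

Lemma coord_enorm u j : `|u 0 j| <= enorm u.
Proof.
rewrite -sqrtr_sqr ler_wsqrtr // /dot (bigD1 j) //= expr2 lerDl.
by apply: sumr_ge0 => k _; rewrite -expr2 sqr_ge0.
Qed.

Lemma norm_enorm u : `|u| <= enorm u.
Proof.
rewrite /Num.norm /= mx_normrE.
apply: bigmax_le => [|[i j] _]; first exact: enorm_ge0.
by rewrite /= ord1 coord_enorm.
Qed.

Lemma enorm0 : enorm (0 : V) = 0.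
Proof. by rewrite /enorm dot0l sqrtr0. Qed.

Lemma cvg_dot (I : Type) (F : set_system I) {FF : Filter F} (f g : I -> V) u v :
  f @ F --> u -> g @ F --> v -> dot (f x) (g x) @[x --> F] --> dot u v.
Proof.
move=> fu gv; apply: cvg_big => [|j _]; first exact: add_continuous.
apply: cvgM; first exact: (cvg_comp _ _ fu (@coord_continuous _ _ _ _ _ u)).
exact: (cvg_comp _ _ gv (@coord_continuous _ _ _ _ _ v)).
Qed.

Lemma cvg_enorm (I : Type) (F : set_system I) {FF : Filter F} (f : I -> V) u :
  f @ F --> u -> enorm (f x) @[x --> F] --> enorm u.
Proof.
move=> fu; apply: (cvg_comp _ _ (cvg_dot fu fu)).
exact: sqrt_continuous.
Qed.

Lemma cvg_enormB (I : Type) (F : set_system I) {FF : Filter F} (f : I -> V) u :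
  f @ F --> u -> enorm (f x - u) @[x --> F] --> 0.
Proof.
move=> fu; rewrite -enorm0 -(subrr u); apply: cvg_enorm.
by apply: cvgB => //; exact: cvg_cst.
Qed.

(** Convergence is meant for the sup norm, which the Euclidean one dominates; the hypotheses only
    provide Euclidean estimates. *)
Lemma cvg_rV_enorm (I : Type) (F : set_system I) {FF : Filter F} (f : I -> V) u :
  (forall eta, 0 < eta -> \forall x \near F, enorm (f x - u) < eta) ->
  f @ F --> u.
Proof.
move=> fu; apply/cvgrPdist_lt => eta eta0.
apply: filterS (fu _ eta0) => x; apply: le_lt_trans.
by rewrite distrC norm_enorm.
Qed.

End EuclideanSpace.

(** * Test functions and their calculus *)

Section C1Functions.
Context {R : realType} {N : nat}.
Local Notation V := 'rV[R]_N.
Implicit Types (f g : V * R -> R) (p q : V * R).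

Lemma C1fun_derivable f p v : C1fun f -> derivable f p v.
Proof. by case=> df _; exact/diff_derivable. Qed.

Lemma C1fun_continuous f : C1fun f -> continuous f.
Proof. by case=> df _ p; exact/differentiable_continuous. Qed.

Lemma C1fun_cst (k : R) : C1fun (fun _ : V * R => k).
Proof.
split=> [p|v]; first exact: differentiable_cst.
rewrite (_ : 'D_v _ = cst 0); first exact: cst_continuous.
by apply/funext => p; rewrite derive_cst.
Qed.

Lemma C1funD f g : C1fun f -> C1fun g -> C1fun (f \+ g).
Proof.
move=> f1 g1; split=> [p|v].
  by apply: differentiableD; [case: f1|case: g1].
rewrite (_ : 'D_v _ = 'D_v f \+ 'D_v g).
  by move=> p; apply: cvgD; [case: f1 => _; exact|case: g1 => _; exact].
by apply/funext => p; apply: deriveD; exact: C1fun_derivable.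
Qed.

Lemma C1funM f g : C1fun f -> C1fun g -> C1fun (f \* g).
Proof.
move=> f1 g1; split=> [p|v].
  by apply: differentiableM; [case: f1|case: g1].
rewrite (_ : 'D_v _ = fun p => f p *: 'D_v g p + g p *: 'D_v f p).
  have [cf cg] := (C1fun_continuous f1, C1fun_continuous g1).
  move=> p; apply: cvgD; apply: cvgM; [exact: cf| | exact: cg|].
    by case: g1 => _; exact.
  by case: f1 => _; exact.
by apply/funext => p; apply: deriveM; exact: C1fun_derivable.
Qed.

Lemma C1funN f : C1fun f -> C1fun (\- f).
Proof.
move=> f1; rewrite (_ : \- f = (fun=> -1) \* f).
  exact: C1funM (C1fun_cst _) f1.
by apply/funext => p /=; rewrite mulN1r.
Qed.

(** Base case of the test functions: all explicit ones are built from linear maps and constants by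
    sums and products. *)
Lemma is_derive_linear (f : V * R -> R) : linear f -> continuous f ->
  C1fun f /\ forall p v, is_derive p v f (f v).
Proof.
move=> lf cf; pose flin := GRing.isLinear.Build _ _ _ _ _ lf.
pose F : {linear (V * R)%type -> R} := HB.pack f flin.
have df p : differentiable f p by exact: (@linear_differentiable _ _ _ F).
have Df p v : 'D_v f p = f v by rewrite deriveE // (@diff_lin _ _ _ F).
split=> [|p v]; last by split; [exact: diff_derivable|exact: Df].
split=> // v; rewrite (_ : 'D_v _ = cst (f v)); first exact: cst_continuous.
by apply/funext => p; rewrite Df.
Qed.

Lemma C1fun_time : C1fun (fun q : V * R => q.2).
Proof. by apply: (@is_derive_linear snd _ _).1 => // p; exact: cvg_snd. Qed.

Lemma is_derive_time p (v : V * R) : is_derive p v (fun q : V * R => q.2) v.2.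
Proof. by apply: (@is_derive_linear snd _ _).2 => // q; exact: cvg_snd. Qed.

Lemma linear_dot_space (w : V) : linear (fun q : V * R => dot w q.1).
Proof. by move=> k q q'; rewrite /= dotDr dotZr. Qed.

Lemma continuous_dot_space (w : V) : continuous (fun q : V * R => dot w q.1).
Proof. by move=> q; apply: cvg_dot; [exact: cvg_cst|exact: cvg_fst]. Qed.

Lemma C1fun_dot (w : V) : C1fun (fun q : V * R => dot w q.1).
Proof.
exact: (is_derive_linear (@linear_dot_space w) (@continuous_dot_space w)).1.
Qed.

Lemma is_derive_dot (w : V) p (v : V * R) :
  is_derive p v (fun q : V * R => dot w q.1) (dot w v.1).
Proof.
exact: (is_derive_linear (@linear_dot_space w) (@continuous_dot_space w)).2.
Qed.

(** A polynomial, hence C^1, unlike the sup norm. Its gradient vanishes at [p], so adding it makes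
    maxima strict or global without changing the derivatives at [p]. *)
Definition sqdist (p q : V * R) : R :=
  dot (q.1 - p.1) (q.1 - p.1) + (q.2 - p.2) ^+ 2.

Lemma sqdistE p : sqdist p = \sum_(j < N)
    (fun q : V * R => dot (delta_mx 0 j) q.1 - p.1 0 j) *
    (fun q : V * R => dot (delta_mx 0 j) q.1 - p.1 0 j)
  + (fun q : V * R => q.2 - p.2) * (fun q : V * R => q.2 - p.2).
Proof.
apply/funext => q; rewrite /sqdist /GRing.add /= fct_sumE expr2; congr (_ + _).
apply: eq_bigr => j _; rewrite !mxE !fctE.
suff -> : dot (delta_mx 0 j) q.1 = q.1 0 j by [].
rewrite /dot (bigD1 j) //= !mxE !eqxx mul1r big1 ?addr0 // => k /negbTE kj.
by rewrite mxE kj andbF mul0r.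
Qed.

Lemma C1fun_sqdist p : C1fun (sqdist p).
Proof.
rewrite sqdistE; apply: C1funD; last first.
  by apply: C1funM; exact: (C1funD C1fun_time (C1fun_cst _)).
apply: big_ind => [|f g|j _]; [exact: C1fun_cst|exact: C1funD|].
by apply: C1funM; exact: (C1funD (C1fun_dot _) (C1fun_cst _)).
Qed.

Lemma derive_sqdist p q v :
  'D_v (sqdist p) q = 2 * (dot (q.1 - p.1) v.1 + (q.2 - p.2) * v.2).
Proof.
apply: cvg_lim => //; set A := (X in _ --> X).
(* For [h != 0] the difference quotient is exactly this affine function of [h]. *)
have : A + h * sqdist 0 v @[h --> 0^'] --> A + 0 * sqdist 0 v.
  apply: cvgD; [exact: cvg_cst|apply: cvgM; last exact: cvg_cst].
  exact: (@nbhs_dnbhs _ 0).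
rewrite mul0r addr0; apply: cvg_trans; apply: near_eq_cvg.
near=> h; have h0 : h != 0 by near: h; exact: nbhs_dnbhs_neq.
rewrite /A /sqdist /= !subr0 -!addrA !dotDl !dotDr !dotZl !dotZr !dotNl !dotNr.
rewrite /GRing.scale /= (dotC p.1) (dotC q.1 v.1); field.
Unshelve. all: by end_near. Qed.

Lemma C1funZ (k : R) f : C1fun f -> C1fun (fun p => k * f p).
Proof. by move=> f1; exact: (C1funM (C1fun_cst k) f1). Qed.

Lemma DxD f g p : C1fun f -> C1fun g ->
  Dx (fun q => f q + g q) p = Dx f p + Dx g p.
Proof.
move=> f1 g1; apply/rowP => j; rewrite !mxE.
by rewrite deriveD //; exact: C1fun_derivable.
Qed.

Lemma DtD f g p : C1fun f -> C1fun g ->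
  Dt (fun q => f q + g q) p = Dt f p + Dt g p.
Proof. by move=> f1 g1; apply: deriveD; exact: C1fun_derivable. Qed.

Lemma DxZ k f p : C1fun f -> Dx (fun q => k * f q) p = k *: Dx f p.
Proof.
move=> f1; apply/rowP => j; rewrite !mxE.
by rewrite deriveZ //; exact: C1fun_derivable.
Qed.

Lemma DtZ k f p : C1fun f -> Dt (fun q => k * f q) p = k * Dt f p.
Proof. by move=> f1; rewrite /Dt deriveZ //; exact: C1fun_derivable. Qed.

Lemma DxN f p : C1fun f -> Dx (\- f) p = - Dx f p.
Proof.
by move=> f1; apply/rowP => j; rewrite !mxE deriveN //; exact: C1fun_derivable.
Qed.

Lemma DtN f p : C1fun f -> Dt (\- f) p = - Dt f p.
Proof. by move=> f1; rewrite /Dt deriveN //; exact: C1fun_derivable. Qed.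

Lemma dot_delta (u : V) j : dot u (delta_mx 0 j) = u 0 j.
Proof.
rewrite /dot (bigD1 j) //= !mxE !eqxx mulr1 big1 ?addr0 // => k /negbTE kj.
by rewrite mxE kj andbF mulr0.
Qed.

Lemma Dx_dot (w : V) p : Dx (fun q : V * R => dot w q.1) p = w.
Proof.
apply/rowP => j; rewrite !mxE.
by have [_ ->] := is_derive_dot w p (delta_mx 0 j, 0); exact: dot_delta.
Qed.

Lemma Dt_dot (w : V) p : Dt (fun q : V * R => dot w q.1) p = 0.
Proof. by rewrite /Dt; have [_ ->] := is_derive_dot w p (0, 1); exact: dot0r. Qed.

Lemma Dt_time p : Dt (fun q : V * R => q.2) p = 1.
Proof. by rewrite /Dt; have [_ ->] := is_derive_time p (0, 1). Qed.

Lemma Dx_time p : Dx (fun q : V * R => q.2) p = 0.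
Proof.
by apply/rowP => j; rewrite !mxE; have [_ ->] := is_derive_time p (delta_mx 0 j, 0).
Qed.

Lemma Dx_sqdist p q : Dx (sqdist p) q = 2 *: (q.1 - p.1).
Proof.
apply/rowP => j; rewrite mxE derive_sqdist /= mulr0 addr0 dot_delta.
by rewrite [RHS]mxE.
Qed.

Lemma Dt_sqdist p q : Dt (sqdist p) q = 2 * (q.2 - p.2).
Proof. by rewrite /Dt derive_sqdist /= dot0r add0r mulr1. Qed.

Lemma continuous_Dx f : C1fun f -> continuous (Dx f).
Proof.
case=> _ cf p; apply/cvgrPdist_lt => eta eta0.
pose D j := 'D_((delta_mx 0 j, 0) : V * R) f.
have : nbhs p [set q | forall j : 'I_N, `|D j p - D j q| < eta].
  apply: (@filter_forall _ _ (fun j q => `|D j p - D j q| < eta) _ (nbhs_filter p)) => j.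
  by have /cvgrPdist_lt := cf (delta_mx 0 j, 0) p; apply.
apply: filterS => q fq; rewrite /Num.norm /= mx_normrE.
apply: bigmax_lt => // -[i j] _ /=; rewrite !mxE; exact: fq.
Qed.

Lemma continuous_Dt f : C1fun f -> continuous (Dt f).
Proof. by case=> _; exact. Qed.

Lemma sqdist_ge0 p q : 0 <= sqdist p q.
Proof. by rewrite addr_ge0 ?dot_ge0 ?sqr_ge0. Qed.

Lemma sqdistxx p : sqdist p p = 0.
Proof. by rewrite /sqdist !subrr dot0l expr0n addr0. Qed.

Lemma norm_sqdist p q : `|q - p| ^+ 2 <= sqdist p q.
Proof.
rewrite prod_normE maxEle; case: ifP => _ /=; last first.
  apply: le_trans (_ : enorm (q.1 - p.1) ^+ 2 <= _).
    by rewrite ler_pXn2r ?nnegrE ?enorm_ge0 // norm_enorm.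
  by rewrite sqr_enorm lerDl sqr_ge0.
by rewrite real_normK ?num_real // lerDr dot_ge0.
Qed.
(** Sublevel sets of [sqdist p] serve as compact neighborhoods of [p] on which maxima are taken. *)
Lemma nbhs_sqdist p W : nbhs p W ->
  exists2 rho, 0 < rho & forall q, sqdist p q <= rho -> W q.
Proof.
move=> /nbhs_normP[e /= e0 eW]; exists ((e / 2) ^+ 2).
  by rewrite exprn_gt0 // divr_gt0.
move=> q qe; apply: eW => /=; rewrite distrC.
have := le_trans (norm_sqdist p q) qe.
rewrite ler_pXn2r ?nnegrE ?divr_ge0 // ?(ltW e0) // => /le_lt_trans; apply.
by rewrite ltr_pdivrMr // ltr_pMr // ltr1n.
Qed.

Lemma closed_sqdist_le p rho : closed [set q | sqdist p q <= rho].
Proof.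
apply: (@closed_comp _ _ (sqdist p) [set x | x <= rho]); last exact: closed_le.
by move=> q _; exact: C1fun_continuous (C1fun_sqdist p) _.
Qed.

Lemma compact_sqdist_le p rho : compact [set q | sqdist p q <= rho].
Proof.
(* The radius [rho + 1] avoids a square root: [x ^+ 2 <= rho] implies [x <= rho + 1]. *)
pose B := [set y : V | `|y - p.1| <= rho + 1].
pose I := [set s : R | `|s - p.2| <= rho + 1].
have cB : compact B.
  apply: bounded_closed_compact.
    exists (rho + 1 + `|p.1|); split=> [|M /ltW hM y By]; first exact: num_real.
    apply: le_trans hM; rewrite -[y in leLHS](subrK p.1).
    by apply: le_trans (ler_normD _ _) _; rewrite lerD2r.
  apply: (@closed_comp _ _ (fun y : V => `|y - p.1|) [set x | x <= rho + 1]);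
    last exact: closed_le.
  move=> y _; have cy : z - p.1 @[z --> y] --> y - p.1.
    by apply: (@cvgB _ V _ (nbhs y) _ id (cst p.1)); [exact: cvg_id|exact: cvg_cst].
  exact: cvg_comp cy (@norm_continuous _ V _).
have cI : compact I.
  rewrite (_ : I = `[p.2 - (rho + 1), p.2 + (rho + 1)]%classic).
    exact: segment_compact.
  by apply/seteqP; split => s; rewrite /I /= in_itv /= ler_distl.
apply: (subclosed_compact (@closed_sqdist_le p rho) (compact_setX cB cI)) => q /= qrho.
have : `|q - p| <= rho + 1.
  have := le_trans (norm_sqdist p q) qrho; have := normr_ge0 (q - p); nra.
rewrite prod_normE ge_max => /andP[]; by split.
Qed.

End C1Functions.

(** * Half-relaxed limits and maxima on compact sets *)

Section HalfRelaxed.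
Context {R : realType} {N : nat}.
Local Notation V := 'rV[R]_N.
Implicit Types (u : R -> V * R -> R) (p q : V * R) (T r eta : R).

Lemma limsup_star_lt T u q r eta : r%:E = limsup_star T u q -> 0 < eta ->
  exists A B, [/\ 0^'+ A, nbhs q B &
    forall e q', A e -> B q' -> QT T q' -> u e q' < r + eta].
Proof.
move=> ur eta0.
have : (limsup_star T u q < (r + eta)%:E)%E by rewrite -ur lte_fin ltrDl.
rewrite /limsup_star limf_esupE => /ereal_inf_lt[_ [W [[A B] [/= A0 Bq] ABW] <-]] Wlt.
exists A, [set q' | QT T q' -> B q']; split=> // e q' Ae Bq' Tq'.
rewrite -lte_fin; apply: le_lt_trans Wlt; apply: ereal_sup_ubound.
by exists (e, q') => //; apply: ABW; split=> //; exact: Bq'.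
Qed.

(** Replaces the extraction of a sequence realizing the limsup: the limsup is at most the supremum
    over [A] and the part of [B] in [QT T], so a value above [r - eta] occurs there. *)
Lemma limsup_star_gt T u q r eta A B : r%:E = limsup_star T u q -> 0 < eta ->
  0^'+ A -> nbhs q B ->
  exists e q', [/\ A e, B q', QT T q' & r - eta < u e q'].
Proof.
move=> ur eta0 A0 Bq; pose W := A `*` [set q' | B q' /\ QT T q'].
have FW : relaxed_filter T q W.
  exists (A, [set q' | B q' /\ QT T q']) => //; split=> //=.
  by apply: filterS Bq => q' Bq' Tq'.
have : ((r - eta)%:E < ereal_sup [set (u w.1 w.2)%:E | w in W])%E.
  have : (limsup_star T u q <= ereal_sup [set (u w.1 w.2)%:E | w in W])%E.
    by apply: ereal_inf_lbound; exists W.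
  by apply: lt_le_trans; rewrite -ur lte_fin ltrBlDr ltrDl.
move=> /ereal_sup_gt[_ [[e q'] [/= Ae [Bq' Tq']] <-]].
by rewrite lte_fin => ?; exists e, q'.
Qed.

(** A bound for [u e] on a neighborhood of [p] is also one near every [q] of its interior, hence
    passes to [ubar q]. *)
Lemma limsup_star_usc T u (ubar : V * R -> R) :
  (forall p, QT T p -> (ubar p)%:E = limsup_star T u p) -> usc_on (QT T) ubar.
Proof.
move=> hu p Tp eta eta0; have eta2 : 0 < eta / 2 by rewrite divr_gt0.
have [A [B [A0 Bp uAB]]] := limsup_star_lt (hu p Tp) eta2.
move/nbhs_interior: Bp; apply: filterS => q Bq Tq.
rewrite -lte_fin; apply: (@le_lt_trans _ _ (ubar p + eta / 2)%:E); last first.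
  by rewrite lte_fin ltrD2l ltr_pdivrMr // ltr_pMr // ltr1n.
rewrite leNgt; apply/negP; rewrite lte_fin => ltu.
have gap0 : 0 < ubar q - (ubar p + eta / 2) by rewrite subr_gt0.
have [e [q' [Ae Bq' Tq' ue]]] :=
  limsup_star_gt (hu q Tq) gap0 A0 Bq.
by have := uAB e q' Ae Bq' Tq'; rewrite subKr in ue; rewrite ltNge (ltW ue).
Qed.

End HalfRelaxed.

Lemma compact_usc_max (X : topologicalType) (R : realType) (K : set X) (f : X -> R) :
  K !=set0 -> compact K ->
  (forall x c, K x -> f x < c -> \forall y \near within K (nbhs x), f y < c) ->
  exists2 x, K x & forall y, K y -> f y <= f x.
Proof.
move=> K0 cK fusc; apply: contrapT => nomax.
have {}nomax x : K x -> exists2 y, K y & f x < f y.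
  move=> Kx; apply: contrapT => nolt; apply: nomax; exists x => // y Ky.
  by rewrite leNgt; apply/negP => lt; apply: nolt; exists y.
(* Superlevel sets of [f], nested since values are totally ordered. Without a maximum, [f z] along
   [F] eventually exceeds [f] near each point of [K]; compactness makes this uniform, and the base
   point [y] of a level set then satisfies [f y < f y]. *)
pose F := filter_from K (fun y => [set z | K z /\ f y <= f z]).
have FF : Filter F.
  apply: filter_from_filter => // x y Kx Ky.
  have [xy|yx] := leP (f x) (f y).
    by exists y => // z [Kz yz]; split; split => //; exact: le_trans yz.
  by exists x => // z [Kz xz]; split; split => //; exact: le_trans (ltW yx) xz.
have [y Ky] : \forall z \near F, K `<=` (fun x => f x < f z).
  move/compact_near_coveringP/near_covering_withinP: cK; apply => // x Kx.
  have [y Ky xy] := nomax x Kx.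
  exists ([set x' | K x' -> f x' < f y], [set z | K z /\ f y <= f z]).
    by split=> /=; [exact: fusc|exists y].
  by case=> x' z [/= x'y [Kz yz]] Kx'; exact: lt_le_trans (x'y Kx') yz.
by move=> /(_ y (conj Ky (lexx _)) y Ky); rewrite ltxx.
Qed.

(** * Existence of penalized maxima *)

Section Stability.
Context {R : realType} {N : nat}.
Local Notation V := 'rV[R]_N.
Implicit Types (p q : V * R).

Lemma QT_itv (T : R) q : 0 < q.2 < T -> QT T q.
Proof. by case/andP => ? ?; rewrite /QT /= !ltW. Qed.

Lemma open_time_itv (T : R) p : 0 < p.2 < T -> \forall q \near p, 0 < q.2 < T.
Proof.
case/andP => p0 pT.
have ct : snd q @[q --> p] --> p.2 by exact: cvg_snd.
near=> q; apply/andP; split; near: q; first exact: (cvgr_gt _ ct).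
exact: (cvgr_lt _ ct).
Unshelve. all: by end_near. Qed.

(* The penalty [C * P] forces the maxima towards the set [P = 0], where [ubar]
   is only assumed to be touched there. *)
Lemma penalized_maxima T (u : R -> V * R -> R) (ubar phi P : V * R -> R) p
    (W : set (R * (V * R))) :
  0 < p.2 < T ->
  (forall e, 0 < e -> usc_on (QT T) (u e)) ->
  (forall q, QT T q -> (ubar q)%:E = limsup_star T u q) ->
  continuous phi -> (forall q, 0 <= P q) -> P p = 0 ->
  (\forall q \near p, {for q, continuous P}) ->
  (\forall q \near p, P q = 0 -> ubar q - phi q <= ubar p - phi p) ->
  filter_prod 0^'+ (nbhs p) W ->
  exists C0, forall C, C0 <= C -> exists e q, [/\ 0 < e, W (e, q), 0 < q.2 < T &
    local_max (fun q' => u e q' - (phi q' + sqdist p q' + C * P q')) q].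
Proof.
move=> pT uusc ulim cphi P0 Pp0 cP Pmax [[A B] [/= A0 Bp] ABW].
have [rho rho0 Hrho] : exists2 rho, 0 < rho & forall q, sqdist p q <= rho ->
    [/\ B q, 0 < q.2 < T, {for q, continuous P} &
        P q = 0 -> ubar q - phi q <= ubar p - phi p].
  apply: nbhs_sqdist; near=> q; split; near: q => //; exact: open_time_itv.
have csq : continuous (sqdist p) by exact: C1fun_continuous (C1fun_sqdist p).
set m := ubar p - phi p in Pmax Hrho.
(* On this sphere [sqdist] costs [rho]. Bounding the rest by [m + rho / 2] leaves values below
   [m - rho / 2], whereas larger values occur near [p]; the maximum over the ball is therefore
   interior, hence local. *)
pose S := [set q | sqdist p q = rho].
have cS : compact S.
  apply: (@subclosed_compact _ S [set q | sqdist p q <= rho]).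
  - apply: (@closed_comp _ _ (sqdist p) [set x | x = rho]); last exact: closed_eq.
    by move=> q _; exact: csq.
  - exact: compact_sqdist_le.
  - by move=> q /= ->.
have rho4 : 0 < rho / 4 by rewrite divr_gt0.
have [[A1 D] [/= A10 Dy] SAD] : \forall w \near filter_prod 0^'+ +oo,
    S `<=` (fun q => u w.1 q - (phi q + w.2 * P q) < m + rho / 2).
  move/compact_near_coveringP: cS; apply => q Sq.
  have [Bq qT cPq Pq] : [/\ B q, 0 < q.2 < T, {for q, continuous P} &
        P q = 0 -> ubar q - phi q <= m] by apply: Hrho; rewrite Sq.
  have [Pq0|Pq0] := eqVneq (P q) 0.
    have [A' [B' [A'0 B'q uAB]]] := limsup_star_lt (ulim q (QT_itv qT)) rho4.
    exists ([set q' | [/\ B' q', 0 < q'.2 < T & phi q - rho / 4 < phi q']],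
      A' `*` [set C | 0 <= C]).
      split=> /=.
        near=> q'; split; near: q' => //; first exact: open_time_itv.
        by apply: (cvgr_gt _ (cphi q)); rewrite ltrBlDr ltrDl.
      exists (A', [set C | 0 <= C]) => //; split=> //.
      exact: (nbhs_pinfty_ge (num_real _)).
    case=> q' [e C] [/= [B'q' q'T phiq'] [/= A'e C0]].
    have := uAB e q' A'e B'q' (QT_itv q'T); have := Pq Pq0.
    have := mulr_ge0 C0 (P0 q'); lra.
  have {Pq0}Pq0 : 0 < P q by rewrite lt_neqAle eq_sym Pq0 P0.
  have [A' [B' [A'0 B'q uAB]]] := limsup_star_lt (ulim q (QT_itv qT)) ltr01.
  (* With [C1 <= C] and [P q' > P q / 2], the penalty exceeds the whole gap between the local bound
     on [u e - phi] and [m]. *)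
  pose C1 := (`|ubar q + 1 - phi q + 1 - m|) * 2 / P q.
  exists ([set q' | [/\ B' q', 0 < q'.2 < T, phi q - 1 < phi q' & P q / 2 < P q']],
    A' `*` [set C | C1 <= C]).
    split=> /=.
      near=> q'; split; near: q' => //; first exact: open_time_itv.
        by apply: (cvgr_gt _ (cphi q)); rewrite ltrBlDr ltrDl.
      by apply: (cvgr_gt _ cPq); rewrite ltr_pdivrMr // ltr_pMr // ltr1n.
    exists (A', [set C | C1 <= C]) => //; split=> //.
    exact: (nbhs_pinfty_ge (num_real _)).
  case=> q' [e C] [/= [B'q' q'T phiq' Pq'] [/= A'e CC1]].
  have := uAB e q' A'e B'q' (QT_itv q'T).
  have : `|ubar q + 1 - phi q + 1 - m| <= C * P q'.
    rewrite (_ : `|_| = C1 * (P q / 2)); last by rewrite /C1; field; rewrite gt_eqF.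
    have C10 : 0 <= C1 by rewrite /C1 divr_ge0 ?mulr_ge0 // ltW.
    by apply: ler_pM => //; [rewrite divr_ge0 // ltW|exact: ltW].
  have := ler_norm (ubar q + 1 - phi q + 1 - m); lra.
case: Dy => M [_ MD]; exists (Num.max (M + 1) 0) => C; rewrite ge_max.
move=> /andP[MC C0]; have {}MC : D C by apply: MD; rewrite (lt_le_trans _ MC) // ltrDl.
pose w q := phi q + sqdist p q + C * P q.
have cw q : sqdist p q <= rho -> {for q, continuous w}.
  move=> /Hrho[_ _ cPq _]; apply: cvgD; first by apply: cvgD; [exact: cphi|exact: csq].
  by apply: cvgM; [exact: cvg_cst|exact: cPq].
(* The pair is chosen after [C], because the neighborhood where [w] is close to [w p] depends on
   [C]; the sphere estimate holds for all such [C] on the fixed set [A1]. *)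
have [e [q0 [[[Ae A1e] e0] [q0rho wq0] Tq0 uq0]]] : exists e q', [/\ (A `&` A1) e /\ 0 < e,
    sqdist p q' <= rho /\ w q' < w p + rho / 4, QT T q' & ubar p - rho / 4 < u e q'].
  have prho : sqdist p p < rho by rewrite sqdistxx.
  apply: (limsup_star_gt (A := fun e => (A `&` A1) e /\ 0 < e)
    (B := fun q' => sqdist p q' <= rho /\ w q' < w p + rho / 4)
    (ulim p (QT_itv pT)) rho4).
    near=> e; split; [split|]; near: e => //; exact: nbhs_right_gt.
  near=> q; split; near: q; last first.
    by apply: (cvgr_lt _ (cw p (ltW prho))); rewrite ltrDl.
  exact: (cvgr_le _ (csq p)).
pose K := [set q | sqdist p q <= rho].
have [q Kq qmax] : exists2 q, K q & forall q', K q' -> u e q' - w q' <= u e q - w q.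
  apply: (compact_usc_max (f := fun q => u e q - w q)); [by exists q0|exact: compact_sqdist_le|].
  move=> q c Kq qc; pose d := (c - (u e q - w q)) / 2.
  have d0 : 0 < d by rewrite divr_gt0 // subr_gt0.
  have := uusc e e0 q (QT_itv (let: And4 _ h _ _ := Hrho q Kq in h)) d d0.
  have : \forall q' \near q, w q - d < w q'.
    by apply: (cvgr_gt _ (cw q Kq)); rewrite ltrBlDr ltrDl.
  apply: filterS2 => q' wq' uq' Kq'.
  have [_ /QT_itv Tq' _ _] := Hrho q' Kq'; move: (uq' Tq') wq'.
  rewrite /d; lra.
exists e, q; have [Bq qT _ _] := Hrho q Kq; split=> //; first exact: ABW.
have : sqdist p q < rho.
  rewrite lt_neqAle Kq andbT; apply/eqP => qrho.
  have := SAD (e, C) (conj A1e MC) q qrho; have := qmax q0 q0rho.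
  move: wq0; rewrite /w /= sqdistxx Pp0 qrho /m; move: uq0; lra.
move=> /(cvgr_lt _ (csq q)); apply: filterS => q' q'rho.
by apply: qmax; exact: ltW.
Unshelve. all: by end_near. Qed.

End Stability.

(** * Gradients, normals and Taylor estimates *)

Section Gradients.
Context {R : realType} {N : nat}.
Local Notation V := 'rV[R]_N.
Implicit Types (psi : V -> R) (x y z v : V).

Lemma derive_grad psi y v : differentiable psi y -> 'D_v psi y = dot (grad psi y) v.
Proof.
move=> dpsi; rewrite deriveE // {1}(row_sum_delta v) linear_sum.
apply: eq_bigr => j _; rewrite linearZ /= mxE deriveE // mulrC.
by congr (_ * _).
Qed.

Lemma derive_gt0_near psi y v : differentiable psi y -> 0 < 'D_v psi y ->
  \forall h \near 0^'+, psi y < psi (h *: v + y).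
Proof.
move=> /(@diff_derivable _ _ _ _ _ v) dpsi Dpos.
have hq := cvgr_gt _ (cvg_dnbhs_at_right dpsi) _ Dpos.
near=> h; have h0 : 0 < h by near: h; exact: nbhs_right_gt.
have : 0 < h^-1 * (psi (h *: v + y) - psi y) by near: h; exact: hq.
by rewrite pmulr_rgt0 ?invr_gt0 // subr_gt0.
Unshelve. all: by end_near. Qed.

Definition unit_grad psi y : V := (enorm (grad psi y))^-1 *: grad psi y.

Lemma dot_unit_grad psi y : grad psi y != 0 -> dot (unit_grad psi y) (unit_grad psi y) = 1.
Proof.
move=> /enorm_gt0 g0; rewrite dotZl dotZr -sqr_enorm; field.
by rewrite gt_eqF.
Qed.

Lemma grad_unit_grad psi y v : grad psi y != 0 ->
  dot (grad psi y) v = enorm (grad psi y) * dot (unit_grad psi y) v.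
Proof. by move=> g0; rewrite dotZl mulrA mulfV ?mul1r // gt_eqF // enorm_gt0. Qed.

(** If the unit gradients differed, moving along their difference would make [psi] positive and
    [psi'] negative. This shows that the normal does not depend on the equation chosen for the
    hypersurface. *)
Lemma unit_grad_eq psi psi' z :
  differentiable psi z -> differentiable psi' z ->
  grad psi z != 0 -> grad psi' z != 0 -> psi z = 0 -> psi' z = 0 ->
  (\forall y \near z, 0 < psi y -> 0 <= psi' y) ->
  unit_grad psi z = unit_grad psi' z.
Proof.
move=> d d' g0 g0' z0 z0' hpos.
set nu := unit_grad psi z; set nu' := unit_grad psi' z.
have nn : dot nu nu = 1 by exact: dot_unit_grad.
have nn' : dot nu' nu' = 1 by exact: dot_unit_grad.
have [lt1|ge1] := ltP (dot nu nu') 1.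
  have Dpos : 0 < 'D_(nu - nu') psi z.
    rewrite derive_grad // grad_unit_grad // -/nu dotBr nn.
    by rewrite mulr_gt0 ?subr_gt0 ?enorm_gt0.
  have Dneg : 0 < 'D_(nu - nu') (\- psi') z.
    rewrite deriveN; last exact: diff_derivable.
    rewrite derive_grad // grad_unit_grad // -/nu' dotBr nn' (dotC nu') -mulrN.
    by rewrite mulr_gt0 ?enorm_gt0 // opprB subr_gt0.
  have dN : differentiable (\- psi') z by exact: differentiableN.
  have cz : h *: (nu - nu') + z @[h --> 0^'+] --> z.
    have c0 : h *: (nu - nu') @[h --> 0^'+] --> 0 *: (nu - nu').
      by apply: cvgZr_tmp; apply: cvg_at_right_filter; exact: cvg_id.
    have := cvgD c0 (@cvg_cst V z R 0^'+ _).
    by rewrite scale0r add0r; apply.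
  have [h [/= ph ph' hh]] : exists h, [/\ psi z < psi (h *: (nu - nu') + z),
      - psi' z < - psi' (h *: (nu - nu') + z) &
      0 < psi (h *: (nu - nu') + z) -> 0 <= psi' (h *: (nu - nu') + z)].
    apply: (@filter_ex _ 0^'+); near=> h; split; near: h.
    - exact: derive_gt0_near.
    - exact: (derive_gt0_near dN).
    - exact: (cz _ hpos).
  by move: ph ph' hh; rewrite z0 z0' oppr0 oppr_gt0 leNgt => -> -> /(_ isT).
(* Two unit vectors with scalar product at least 1: the square of their difference is
   [2 - 2 * dot nu nu'], hence not positive. *)
apply/eqP; rewrite -subr_eq0; apply/negPn/negP => /dot_gt0.
by rewrite dotBl !dotBr nn nn' (dotC nu'); apply/negP; rewrite -leNgt; lra.
Unshelve. all: by end_near. Qed.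

Lemma is_derive_line psi y v (s : R) : differentiable psi (y + s *: v) ->
  is_derive s 1 (fun h => psi (y + h *: v)) (dot (grad psi (y + s *: v)) v).
Proof.
move=> dpsi; have dv : derivable psi (y + s *: v) v by exact: diff_derivable.
have E : (fun h : R => h^-1 *: (((fun h => psi (y + h *: v)) \o shift s) (h *: 1)
      - psi (y + s *: v))) =
    (fun h => h^-1 *: ((psi \o shift (y + s *: v)) (h *: v) - psi (y + s *: v))).
  apply/funext => h; have -> : h *: (1 : R) = h by rewrite /GRing.scale /= mulr1.
  by rewrite /= scalerDl addrCA.
split; first by rewrite /derivable E; exact: dv.
by rewrite /derive E; exact: derive_grad.
Qed.

(** Mean value theorem on the segment, which stays in the ball by convexity, then the Lipschitz
    bound on the gradient. The constant is [L], not [L / 2], because a mean value replaces the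
    integral. *)
Lemma quadratic_bound psi x (r L : R) y z :
  (forall y, enorm (y - x) < r -> differentiable psi y) ->
  (forall y z, enorm (y - x) < r -> enorm (z - x) < r ->
    enorm (grad psi y - grad psi z) <= L * enorm (y - z)) ->
  0 <= L -> enorm (y - x) < r -> enorm (z - x) < r ->
  `|psi z - psi y - dot (grad psi y) (z - y)| <= L * enorm (z - y) ^+ 2.
Proof.
move=> dpsi Lpsi L0 yr zr; pose v : V := z - y.
have inr (s : R) : s \in `[0, 1] -> enorm (y + s *: v - x) < r.
  rewrite in_itv /= => /andP[s0 s1].
  have -> : y + s *: v - x = (1 - s) *: (y - x) + s *: (z - x).
    by apply/rowP => j; rewrite !mxE; ring.
  apply: le_lt_trans (ler_enormD _ _) _.
  rewrite !enormZ !ger0_norm ?subr_ge0 //.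
  have [->|s_neq0] := eqVneq s 0; first by rewrite subr0 mul1r mul0r addr0.
  have {s_neq0}s0 : 0 < s by rewrite lt_neqAle eq_sym s_neq0.
  nra.
have der (s : R) : s \in `[0, 1] ->
    is_derive s 1 (fun h => psi (y + h *: v)) (dot (grad psi (y + s *: v)) v).
  by move=> /inr /dpsi; exact: is_derive_line.
rewrite -/v; have [s s01] := MVT_segment ler01
  (fun (s : R) s01 => der s (subset_itv_oo_cc s01))
  (derivable_within_continuous (fun (s : R) s01 => @ex_derive _ _ _ _ _ _ _ (der s s01))).
have yv : y + v = z by rewrite /v addrC subrK.
rewrite scale1r scale0r addr0 subr0 mulr1 yv => ->.
rewrite -dotBl; apply: le_trans (dot_enorm _ _) _.
rewrite expr2 mulrA ler_wpM2r ?enorm_ge0 //.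
apply: le_trans (Lpsi _ _ (inr s s01) yr) _; rewrite ler_wpM2l //.
rewrite (addrC y) addrK.
move: s01; rewrite in_itv /= => /andP[s0 s1]; rewrite enormZ ger0_norm //.
by rewrite ler_piMl // enorm_ge0.
Qed.

End Gradients.

(** * Local description of the interface *)

Definition side (R : realType) (i : bool) : R := if i then 1 else -1.

(** Outward normals are specified point by point and side by side, each with its own equation. Here
    one [psi], negative on [Omega true], describes both sides and all normals near [x]. *)
Definition interface_chart (R : realType) (N : nat) (Omega : bool -> set 'rV[R]_N)
    (H : set 'rV[R]_N) (n : bool -> 'rV[R]_N -> 'rV[R]_N) (x : 'rV[R]_N)
    (r L : R) (psi : 'rV[R]_N -> R) : Prop :=
  [/\ forall y, enorm (y - x) < r -> differentiable psi y /\ grad psi y != 0,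
      forall y z, enorm (y - x) < r -> enorm (z - x) < r ->
        enorm (grad psi y - grad psi z) <= L * enorm (y - z),
      forall y, enorm (y - x) < r -> (H y <-> psi y = 0),
      forall i y, enorm (y - x) < r -> Omega i y -> side R i * psi y < 0
    & forall i y, enorm (y - x) < r -> H y -> n i y = side R i *: unit_grad psi y].

Section Interface.
Context {R : realType} {N : nat}.
Local Notation V := 'rV[R]_N.
Variables (Omega : bool -> set V) (H : set V) (n : bool -> V -> V).
Hypothesis hOmega : H_Omega Omega H.
Hypothesis hn : forall i z, H z -> outward_unit_normal (Omega i) z (n i z).

Lemma interface_closure i z : H z -> closure (Omega i) z.
Proof. by case: hOmega => _ _ _ /(_ i) -> _ []. Qed.

Lemma interface_notin i z : H z -> ~ Omega i z.
Proof.
case: hOmega => op _ _ /(_ i) -> _ [_]; apply: contra_not => Oz.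
by apply: open_nbhs_nbhs; split => //; exact: op.
Qed.

Lemma space_cover z : [\/ Omega true z, Omega false z | H z].
Proof.
have [_ _ cov _ _] := hOmega.
have : [set: V] z by [].
by rewrite cov => -[[]|]; [constructor 1|constructor 2|constructor 3].
Qed.

Lemma closure_side i j z : Omega i z -> closure (Omega j) z -> i = j.
Proof.
have [op dis _ _ _] := hOmega => Oi /(_ (Omega i) (open_nbhs_nbhs (conj (op i) Oi))).
case=> y [Ojy Oiy]; case: i j Oi Ojy Oiy => -[] // _ Oy Oy'.
  by have : (Omega true `&` Omega false) y by []; rewrite dis.
by have : (Omega true `&` Omega false) y by []; rewrite dis.
Qed.

Lemma closed_interface : closed H.
Proof.
case: hOmega => op _ _ /(_ true) -> _.
by apply: closedI; [exact: closed_closure|exact/open_closedC/open_interior].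
Qed.

Lemma enorm_nbhs (x : V) (r : R) : 0 < r -> \forall y \near x, enorm (y - x) < r.
Proof.
move=> r0; have cx : y - x @[y --> x] --> x - x.
  by apply: (@cvgB _ V _ (nbhs x) _ id (cst x)); [exact: cvg_id|exact: cvg_cst].
by apply: (cvgr_lt _ (cvg_enorm cx)); rewrite subrr enorm0.
Qed.

Lemma enorm_open (x y : V) (r : R) : enorm (y - x) < r ->
  \forall z \near y, enorm (z - x) < r.
Proof.
rewrite -subr_gt0 => /(enorm_nbhs y); apply: filterS => z zy.
rewrite -(subrK y z) -addrA; apply: le_lt_trans (ler_enormD _ _) _.
by rewrite -ltrBrDr.
Qed.

Lemma nbhs_enorm (x : V) (U : set V) : nbhs x U ->
  exists2 r, 0 < r & forall y, enorm (y - x) < r -> U y.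
Proof.
move=> /nbhs_normP[e /= e0 eU]; exists e => // y ye; apply: eU => /=.
by rewrite distrC (le_lt_trans (norm_enorm _)).
Qed.

(** Take the equation attached to the normal of [Omega true] at [x]; its sign on [Omega false]
    follows by elimination. At nearby points the prescribed normals come from other equations,
    identified by [unit_grad_eq] with [psi] or, for side [false], with [- psi]. *)
Lemma ex_interface_chart x : H x -> exists r L psi,
  [/\ 0 < r, 0 <= L & interface_chart Omega H n x r L psi].
Proof.
move=> Hx; have [U [psi [[oU dpsi [L Lpsi] zpsi] Ux spsi _]]] := hn true Hx.
have [r r0 rU] := nbhs_enorm (open_nbhs_nbhs (conj oU Ux)).
have bd i : boundary (Omega i) = H by case: hOmega => _ _ _ /(_ i).
have dis y : Omega true y -> Omega false y -> False.
  by move=> O1 O2; have := closure_side O1 (subset_closure O2).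
have hpsi y : enorm (y - x) < r -> H y <-> psi y = 0.
  by move=> /rU /zpsi; rewrite bd.
have Ofalse y : enorm (y - x) < r -> Omega false y -> 0 < psi y.
  move=> yr Oy; rewrite lt_neqAle eq_sym leNgt; apply/andP; split.
    by apply/eqP => /(hpsi y yr) /(@interface_notin false).
  by apply/negP => /(spsi y (rU y yr)) /dis; exact.
exists r, `|L|, psi; split=> //; split=> //.
- by move=> y /rU /dpsi.
- move=> y z yr zr; apply: le_trans (Lpsi _ _ (rU _ yr) (rU _ zr)) _.
  by rewrite ler_wpM2r ?enorm_ge0 // ler_norm.
- case=> y yr Oy; rewrite /side.
    by rewrite mul1r; apply/spsi => //; exact: rU.
  by rewrite mulN1r oppr_lt0; exact: Ofalse.
move=> i y yr Hy.
have [U' [psi' [[oU' dpsi' _ zpsi'] U'y spsi' ->]]] := hn i Hy.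
have [dy gy] := dpsi y (rU y yr); have [dy' gy'] := dpsi' y U'y.
have psiy : psi y = 0 by exact/hpsi.
have psiy' : psi' y = 0 by apply/zpsi' => //; rewrite bd.
have U'near : nbhs y U' by exact: open_nbhs_nbhs.
rewrite -/(unit_grad psi' y); case: i spsi' {zpsi'} => spsi' /=.
  rewrite scale1r; apply: unit_grad_eq => //; near=> z => z0.
  have zr : enorm (z - x) < r by near: z; exact: enorm_open.
  rewrite leNgt; apply/negP => /(spsi z (rU z zr)) /spsi'.
  by rewrite ltNge (ltW z0) => hU; apply/notF/hU; near: z.
have gN : grad (\- psi) y = - grad psi y.
  by apply/rowP => j; rewrite !mxE deriveN //; exact: diff_derivable.
have -> : -1 *: unit_grad psi y = unit_grad (\- psi) y.
  by rewrite /unit_grad gN enormN scalerN scaleN1r.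
apply: unit_grad_eq => //=.
- exact: differentiableN.
- by rewrite gN oppr_eq0.
- by rewrite psiy oppr0.
near=> z => z0; have zr : enorm (z - x) < r by near: z; exact: enorm_open.
have U'z : U' z by near: z.
rewrite oppr_ge0; case: (space_cover z) => [/(spsi z (rU z zr))|/(spsi' z U'z)|].
- by move/ltW.
- by rewrite ltNge (ltW z0).
- by move/(hpsi z zr) ->.
Unshelve. all: by end_near. Qed.

End Interface.

(** * Inequalities on suprema, read control by control *)

Lemma sup_addr_le0 (R : realType) (I : Type) (D : set I) (f : I -> R) (c : R) :
  (c%:E + ereal_sup [set (f a)%:E | a in D] <= 0)%E <->
  (forall a, D a -> c + f a <= 0).
Proof.
rewrite addeC -leeBrDr // sub0e; split=> [h a Da|h].
  rewrite addrC -lerBrDr sub0r -lee_fin; apply: le_trans h.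
  by apply: ereal_sup_ubound; exists a.
apply: ge_ereal_sup => _ [a Da <-]; rewrite -EFinN lee_fin.
by rewrite -sub0r lerBrDr addrC h.
Qed.

(** The supremum itself lies strictly below [- c], so the failure is uniform in the control; such a
    margin survives small perturbations. *)
Lemma sup_addr_ge0 (R : realType) (I : Type) (D : set I) (f : I -> R) (c : R) :
  ~ (0 <= c%:E + ereal_sup [set (f a)%:E | a in D])%E ->
  exists2 eta, 0 < eta & forall a, D a -> c + f a <= - eta.
Proof.
move/negP; rewrite -ltNge; set S := ereal_sup _.
have Sub a : D a -> ((f a)%:E <= S)%E.
  by move=> Da; apply: ereal_sup_ubound; exists a.
case: S Sub => [s| |] Sub.
- rewrite -EFinD lte_fin => cs; exists (- (c + s)); first by rewrite oppr_gt0.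
  by move=> a /Sub; rewrite lee_fin opprK lerD2l.
- by rewrite addey.
(* A supremum equal to -oo forces [D] to be empty, so any margin will do. *)
- by move=> _; exists 1 => // a /Sub; rewrite leNgt ltNyr.
Qed.

(** * Uniform convergence of dynamics, costs and Hamiltonian integrands *)

Section Perturbation.
Context {R : realType} {N : nat}.
Local Notation V := 'rV[R]_N.
Variables (Omega : bool -> set V) (H : set V) (n : bool -> V -> V) (T : R).
Variables (A : bool -> metricType R).
Variables (b : forall i, V -> R -> A i -> V) (l : forall i, V -> R -> A i -> R).
Arguments b : clear implicits.
Arguments l : clear implicits.
Variables (be : R -> forall i, V -> R -> A i -> V)
  (le : R -> forall i, V -> R -> A i -> R).
Arguments be : clear implicits.
Arguments le : clear implicits.
Variables (Mb Lb Ml : R) (ml : R -> R).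
Hypothesis hml : modulus ml.
Hypothesis hC1 : forall e, 0 < e -> C1 Omega T (be e) Mb Lb.
Hypothesis hC2 : forall e, 0 < e -> C2 Omega T (le e) Ml ml.
Hypothesis hb_cvg : loc_unif_cvg_dynamics Omega T be b.
Hypothesis hl_cvg : loc_unif_cvg_costs Omega T le l.

Definition st_dist (p q : V * R) : R := enorm (q.1 - p.1) + `|q.2 - p.2|.

Lemma st_dist0 (p q : V * R) : st_dist p q <= 0 -> q = p.
Proof.
have := enorm_ge0 (q.1 - p.1); have := normr_ge0 (q.2 - p.2); rewrite /st_dist.
move=> h2 h1 h; have t0 : `|q.2 - p.2| = 0 by lra.
have {h h2}x0 : enorm (q.1 - p.1) = 0 by lra.
move: q p {h1} x0 t0 => [y s] [x t] /= x0 /eqP; rewrite normr_eq0 subr_eq0 => /eqP ->.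
have [->//|] := eqVneq y x; rewrite -subr_eq0 => /enorm_gt0.
by rewrite x0 ltxx.
Qed.

Lemma cvg_st_dist p : st_dist p q @[q --> p] --> 0.
Proof.
rewrite -[X in _ --> X](addr0 0); apply: cvgD.
  rewrite -[X in _ --> X](@enorm0 R N) -(subrr p.1); apply: cvg_enorm.
  by apply: (@cvgB _ V _ (nbhs p) _ fst (cst p.1)); [exact: cvg_fst|exact: cvg_cst].
rewrite -[X in _ --> X](@normr0 _ R) -(subrr p.2); apply: cvg_norm.
by apply: cvgB; [exact: cvg_snd|exact: cvg_cst].
Qed.

(** The Lipschitz constant common to all [be e] moves from the nearby point to [p]; convergence is
    then used on the compact set reduced to [p.1]. *)
Lemma dynamics_near i (p : V * R) eta : dom Omega T i p -> 0 < eta ->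
  \forall w \near filter_prod 0^'+ (nbhs p), dom Omega T i w.2 ->
    forall a, enorm (be w.1 i w.2.1 w.2.2 a - b i p.1 p.2 a) < eta.
Proof.
move=> [xi tT] eta0; have eta2 : 0 < eta / 2 by rewrite divr_gt0.
have Kx : [set p.1] `<=` closure (Omega i) by move=> _ ->.
have cL : Lb * st_dist p q @[q --> p] --> Lb * 0.
  by apply: cvgM; [exact: cvg_cst|exact: cvg_st_dist].
exists ([set e | 0 < e /\ forall a, enorm (be e i p.1 p.2 a - b i p.1 p.2 a) < eta / 2],
    [set q | Lb * st_dist p q < eta / 2]); first split => /=.
- near=> e; split; first by near: e; exact: nbhs_right_gt.
  move=> a; have : forall z s (a : A i), [set p.1] z -> 0 <= s <= T ->
      enorm (be e i z s a - b i z s a) < eta / 2.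
    by near: e; exact: hb_cvg (@compact_set1 _ _) Kx _ eta2.
  by apply.
- by apply: (cvgr_lt _ cL); rewrite mulr0.
case=> e q [/= [e0 bp] Lq] qi a.
rewrite -(subrK (be e i p.1 p.2 a) (be e i q.1 q.2 a)) -addrA.
apply: le_lt_trans (ler_enormD _ _) _; rewrite [eta]splitr; apply: ltrD => //.
by apply: le_lt_trans Lq; case: (hC1 e0 i) => _ _ _; apply.
Unshelve. all: by end_near. Qed.

Lemma costs_near i (p : V * R) eta : dom Omega T i p -> 0 < eta ->
  \forall w \near filter_prod 0^'+ (nbhs p), dom Omega T i w.2 ->
    forall a, `|le w.1 i w.2.1 w.2.2 a - l i p.1 p.2 a| < eta.
Proof.
move=> [xi tT] eta0; have eta2 : 0 < eta / 2 by rewrite divr_gt0.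
have Kx : [set p.1] `<=` closure (Omega i) by move=> _ ->.
exists ([set e | 0 < e /\ forall a, `|le e i p.1 p.2 a - l i p.1 p.2 a| < eta / 2],
    [set q | 0 < st_dist p q -> ml (st_dist p q) < eta / 2]); first split => /=.
- near=> e; split; first by near: e; exact: nbhs_right_gt.
  move=> a; have : forall z s (a : A i), [set p.1] z -> 0 <= s <= T ->
      `|le e i z s a - l i z s a| < eta / 2.
    by near: e; exact: hl_cvg (@compact_set1 _ _) Kx _ eta2.
  by apply.
- have : \forall r \near 0^'+, ml r < eta / 2.
    exact: (cvgr_lt _ hml.2).
  by move=> /(@cvg_st_dist p).
case=> e q [/= [e0 lp] mq] qi a.
rewrite -(subrK (le e i p.1 p.2 a) (le e i q.1 q.2 a)) -addrA.
apply: le_lt_trans (ler_normD _ _) _; rewrite [eta]splitr; apply: ltr_leD; last exact: ltW.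
(* [modulus] controls [ml] as its argument tends to 0 from the right and does not force [ml 0 = 0],
   so coincident points are handled separately. *)
have [/mq|/st_dist0 ->] := ltP 0 (st_dist p q); last by rewrite subrr normr0.
by apply: le_lt_trans; case: (hC2 e0 i) => _ _; apply.
Unshelve. all: by end_near. Qed.

(** The bound on [b] is inherited from one [be e] that is within 1 of it at [p]. *)
Lemma dynamics_bound i p a : dom Omega T i p -> enorm (b i p.1 p.2 a) <= `|Mb| + 1.
Proof.
move=> pi; have [[E Q] /= [E0 Qp] EQ] := dynamics_near pi ltr01.
have [e [Ee e0]] : exists e, E e /\ 0 < e.
  by apply: (@filter_ex _ 0^'+); apply: filterI => //; exact: nbhs_right_gt.
have bb : enorm (be e i p.1 p.2 a - b i p.1 p.2 a) < 1.
  exact: (EQ (e, p) (conj Ee (nbhs_singleton Qp)) pi).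
have bM : enorm (be e i p.1 p.2 a) <= Mb.
  have [_ _ + _] := hC1 e0 i; apply; exact: pi.
rewrite -[b i p.1 p.2 a](subKr (be e i p.1 p.2 a)).
apply: le_trans (ler_enormD _ _) _; rewrite enormN; apply: lerD; last exact: ltW.
exact: le_trans bM (ler_norm _).
Qed.

(* Uniformly in the control, [c - b . G - l] is continuous up to the limit in
   [eps]; no continuity of the Hamiltonians themselves is needed. *)
Lemma hamiltonian_near i (p : V * R) (G : V * R -> V) (c : V * R -> R) eta :
  {for p, continuous G} -> {for p, continuous c} -> dom Omega T i p -> 0 < eta ->
  \forall w \near filter_prod 0^'+ (nbhs p), dom Omega T i w.2 ->
    forall a, `|(c w.2 + (- dot (be w.1 i w.2.1 w.2.2 a) (G w.2) - le w.1 i w.2.1 w.2.2 a))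
      - (c p + (- dot (b i p.1 p.2 a) (G p) - l i p.1 p.2 a))| < eta.
Proof.
(* Four quarters of [eta]: the variation of [c], that of the cost, the change of dynamics against
   [G w.2] (bounded by [K]), and the change of [G] against [b] (bounded by [M]). *)
move=> cG cc pi eta0; have eta4 : 0 < eta / 4 by rewrite divr_gt0.
pose M := `|Mb| + 1; have M0 : 0 < M by rewrite ltr_wpDl.
pose K := enorm (G p) + 1; have K0 : 0 < K by rewrite ltr_wpDl ?enorm_ge0.
have etaK : 0 < eta / 4 / K by rewrite divr_gt0.
have cq : snd @ filter_prod (0 : R)^'+ (nbhs p) --> p by exact: cvg_snd.
have Gnear : \forall q \near p, enorm (G q) < K /\ M * enorm (G q - G p) < eta / 4.
  near=> q; split; near: q; first by apply: (cvgr_lt _ (cvg_enorm cG)); rewrite ltrDl.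
  have cGM : M * enorm (G q - G p) @[q --> p] --> M * enorm (G p - G p).
    apply: cvgM; first exact: cvg_cst.
    apply: cvg_enorm.
    by apply: (@cvgB _ V _ (nbhs p) _ G (cst (G p))) => //; exact: cvg_cst.
  by apply: (cvgr_lt _ cGM); rewrite subrr enorm0 mulr0.
have cnear : \forall q \near p, `|c q - c p| < eta / 4.
  by have /cvgrPdistC_lt := cc; apply.
near=> w => wi a.
have hb : enorm (be w.1 i w.2.1 w.2.2 a - b i p.1 p.2 a) < eta / 4 / K.
  suff : dom Omega T i w.2 -> forall a,
    enorm (be w.1 i w.2.1 w.2.2 a - b i p.1 p.2 a) < eta / 4 / K by apply.
  by near: w; exact: dynamics_near.
have hl : `|le w.1 i w.2.1 w.2.2 a - l i p.1 p.2 a| < eta / 4.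
  suff : dom Omega T i w.2 -> forall a,
    `|le w.1 i w.2.1 w.2.2 a - l i p.1 p.2 a| < eta / 4 by apply.
  by near: w; exact: costs_near.
have [hG hGM] : enorm (G w.2) < K /\ M * enorm (G w.2 - G p) < eta / 4.
  by near: w; exact: (cq _ Gnear).
have hc : `|c w.2 - c p| < eta / 4 by near: w; exact: (cq _ cnear).
have h1 : `|dot (be w.1 i w.2.1 w.2.2 a - b i p.1 p.2 a) (G w.2)| < eta / 4.
  apply: le_lt_trans (dot_enorm _ _) _; rewrite -[ltRHS](divfK (lt0r_neq0 K0)).
  apply: (@le_lt_trans _ _ (eta / 4 / K * enorm (G w.2))).
    by rewrite ler_wpM2r ?enorm_ge0 // ltW.
  by rewrite ltr_pM2l.
have h2 : `|dot (b i p.1 p.2 a) (G w.2 - G p)| < eta / 4.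
  apply: le_lt_trans (dot_enorm _ _) _; apply: le_lt_trans hGM.
  by rewrite ler_wpM2r ?enorm_ge0 // dynamics_bound.
move: hc hl h1 h2; rewrite dotBl dotBr !ltr_norml.
move=> /andP[? ?] /andP[? ?] /andP[? ?] /andP[? ?]; apply/andP; split; lra.
Unshelve. all: by end_near. Qed.

End Perturbation.

Lemma min_addr_le0 (R : realType) (c : R) (X Y : \bar R) :
  (c%:E + Order.min X Y <= 0)%E <-> (c%:E + X <= 0)%E \/ (c%:E + Y <= 0)%E.
Proof.
rewrite minEle; case: ifPn => [XY|]; last rewrite -ltNge => /ltW YX.
  split=> [|[//|]]; first by left.
  by apply: le_trans; exact: leeD.
split=> [|[|//]]; first by right.
by apply: le_trans; exact: leeD.
Qed.

Lemma max_addr_ge0 (R : realType) (c : R) (X Y : \bar R) :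
  (0 <= c%:E + Order.max X Y)%E <-> (0 <= c%:E + X)%E \/ (0 <= c%:E + Y)%E.
Proof.
rewrite maxEle; case: ifPn => [XY|]; last rewrite -ltNge => /ltW YX.
  split=> [|[|//]]; first by right.
  by move=> /le_trans; apply; exact: leeD.
split=> [|[//|]]; first by left.
by move=> /le_trans; apply; exact: leeD.
Qed.

(** * Stability of the inequalities in the domains and on the interface *)

Section OneSided.
Context {R : realType} {N : nat}.
Local Notation V := 'rV[R]_N.
Variables (Omega : bool -> set V) (H : set V) (n : bool -> V -> V) (T : R).
Hypothesis hOmega : H_Omega Omega H.
Variables (A : bool -> metricType R).

(* On the interface as well as inside [Omega i], the viscosity inequality says
   that one of the Hamiltonians living at the point satisfies it. *)
Definition one_sided_sub (b : forall i, V -> R -> A i -> V)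
    (l : forall i, V -> R -> A i -> R) (u : V * R -> R) : Prop :=
  forall phi, C1fun phi -> forall x t, 0 < t < T ->
    local_max (u \- phi) (x, t) -> exists2 i, closure (Omega i) x &
    ((Dt phi (x, t))%:E + Ham b l i x t (Dx phi (x, t)) <= 0)%E.

Definition one_sided_super (b : forall i, V -> R -> A i -> V)
    (l : forall i, V -> R -> A i -> R) (v : V * R -> R) : Prop :=
  forall phi, C1fun phi -> forall x t, 0 < t < T ->
    local_min (v \- phi) (x, t) -> exists2 i, closure (Omega i) x &
    (0 <= (Dt phi (x, t))%:E + Ham b l i x t (Dx phi (x, t)))%E.

Section Characterization.
Variables (b : forall i, V -> R -> A i -> V) (l : forall i, V -> R -> A i -> R).

Lemma subsolution_one_sided J u :
  subsolution Omega H n T b l J u -> one_sided_sub b l u.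
Proof.
case=> _ int ifc _ phi phi1 x t tT umax.
have [Ox|Ox|Hx] := space_cover hOmega x.
- by exists true; [exact: (subset_closure Ox)|exact: int].
- by exists false; [exact: (subset_closure Ox)|exact: int].
have /min_addr_le0[] := ifc phi phi1 x t Hx tT umax.
  by exists true => //; exact: (interface_closure hOmega _ Hx).
by exists false => //; exact: (interface_closure hOmega _ Hx).
Qed.

Lemma one_sided_subsolution J u : bounded_on (QT T) u -> usc_on (QT T) u ->
  one_sided_sub b l u -> tangential_subsolution H n b l J u ->
  subsolution Omega H n T b l J u.
Proof.
move=> ub uusc uside utan; split=> //.
  move=> i phi phi1 x t Ox tT /(uside phi phi1 x t tT)[j clj].
  by rewrite (closure_side hOmega Ox clj).
move=> phi phi1 x t Hx tT /(uside phi phi1 x t tT)[j clj h].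
by apply/min_addr_le0; case: j clj h; [left|right].
Qed.

Lemma supersolution_one_sided v :
  supersolution Omega H T b l v -> one_sided_super b l v.
Proof.
case=> _ int ifc phi phi1 x t tT vmin.
have [Ox|Ox|Hx] := space_cover hOmega x.
- by exists true; [exact: (subset_closure Ox)|exact: int].
- by exists false; [exact: (subset_closure Ox)|exact: int].
have /max_addr_ge0[] := ifc phi phi1 x t Hx tT vmin.
  by exists true => //; exact: (interface_closure hOmega _ Hx).
by exists false => //; exact: (interface_closure hOmega _ Hx).
Qed.

Lemma one_sided_supersolution v : bounded_on (QT T) v -> lsc_on (QT T) v ->
  one_sided_super b l v -> supersolution Omega H T b l v.
Proof.
move=> vb vlsc vside; split=> //.
  move=> i phi phi1 x t Ox tT /(vside phi phi1 x t tT)[j clj].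
  by rewrite (closure_side hOmega Ox clj).
move=> phi phi1 x t Hx tT /(vside phi phi1 x t tT)[j clj h].
by apply/max_addr_ge0; case: j clj h; [left|right].
Qed.

End Characterization.

(** The complement of a closure is open: a side absent at [x] is absent nearby, so no Hamiltonian
    can enter in the limit. *)
Lemma notin_closure_near i x (t : R) : ~ closure (Omega i) x ->
  \forall w \near filter_prod (0 : R)^'+ (nbhs ((x, t) : V * R)),
    ~ closure (Omega i) w.2.1.
Proof.
move=> xi; have ox : open (~` closure (Omega i)).
  by apply: closed_openC; exact: closed_closure.
have c1 : fst q @[q --> ((x, t) : V * R)] --> x by exact: cvg_fst.
exists (setT, [set q | ~ closure (Omega i) q.1]) => /=; last by move=> w [].
by split; [exact: filterT|exact: (c1 _ (open_nbhs_nbhs (conj ox xi)))].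
Qed.

(** The case [P = 0] of the penalized statement, where any admissible [C] disappears. *)
Lemma relaxed_maxima (u : R -> V * R -> R) (ubar phi : V * R -> R) p
    (W : set (R * (V * R))) :
  0 < p.2 < T -> (forall e, 0 < e -> usc_on (QT T) (u e)) ->
  (forall q, QT T q -> (ubar q)%:E = limsup_star T u q) ->
  continuous phi -> local_max (ubar \- phi) p ->
  filter_prod 0^'+ (nbhs p) W ->
  exists e q, [/\ 0 < e, W (e, q), 0 < q.2 < T &
    local_max (u e \- (phi \+ sqdist p)) q].
Proof.
move=> pT uusc ulim cphi pmax FW.
have [||||C0 /(_ C0 (lexx _))[e [q [e0 Wq qT qmax]]]] :=
  penalized_maxima (P := fun=> 0) pT uusc ulim cphi _ _ _ _ FW => //.
- by near=> q; exact: cst_continuous.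
- by apply: filterS pmax => q + _.
exists e, q; split=> //; apply: filterS qmax => q' /=.
by rewrite !mulr0 !addr0.
Unshelve. all: by end_near. Qed.

Variables (b : forall i, V -> R -> A i -> V) (l : forall i, V -> R -> A i -> R).
Variables (be : R -> forall i, V -> R -> A i -> V)
  (le : R -> forall i, V -> R -> A i -> R).
Variables (Mb Lb Ml : R) (ml : R -> R).
Hypothesis hml : modulus ml.
Hypothesis hC1 : forall e, 0 < e -> C1 Omega T (be e) Mb Lb.
Hypothesis hC2 : forall e, 0 < e -> C2 Omega T (le e) Ml ml.
Hypothesis hb_cvg : loc_unif_cvg_dynamics Omega T be b.
Hypothesis hl_cvg : loc_unif_cvg_costs Omega T le l.

(** If every side present at [x] failed, a control would witness each failure strictly, and it would
    still do so for the perturbed data at nearby maxima of [u e - theta], where some side must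
    hold. *)
Lemma limit_one_sided_sub (u : R -> V * R -> R) (ubar : V * R -> R) :
  (forall e, 0 < e -> usc_on (QT T) (u e)) ->
  (forall e, 0 < e -> one_sided_sub (be e) (le e) (u e)) ->
  (forall q, QT T q -> (ubar q)%:E = limsup_star T u q) ->
  one_sided_sub b l ubar.
Proof.
move=> uusc uside ulim phi phi1 x t tT umax; apply: contrapT => noside.
pose theta := phi \+ sqdist (x, t).
have theta1 : C1fun theta by exact: C1funD phi1 (C1fun_sqdist _).
have DxE : Dx theta (x, t) = Dx phi (x, t).
  by rewrite DxD ?Dx_sqdist ?subrr ?scaler0 ?addr0 //; exact: C1fun_sqdist.
have DtE : Dt theta (x, t) = Dt phi (x, t).
  by rewrite DtD ?Dt_sqdist ?subrr ?mulr0 ?addr0 //; exact: C1fun_sqdist.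
have FW i : \forall w \near filter_prod 0^'+ (nbhs ((x, t) : V * R)),
    dom Omega T i w.2 -> ~ ((Dt theta w.2)%:E
      + Ham (be w.1) (le w.1) i w.2.1 w.2.2 (Dx theta w.2) <= 0)%E.
  have [xi|xi] := pselect (closure (Omega i) x); last first.
    by apply: filterS (notin_closure_near t xi) => w + [].
  have [a ha] : exists a, 0 < Dt phi (x, t) +
      (- dot (b x t a) (Dx phi (x, t)) - l x t (a : A i)).
    apply: contrapT => noa; apply: noside; exists i => //; apply/sup_addr_le0 => a _.
    by rewrite leNgt; apply/negP => ha; apply: noa; exists a.
  have pi : dom Omega T i (x, t) by split=> //=; case/andP: tT => /ltW -> /ltW ->.
  (* The tolerance is the positive value itself: a smaller perturbation cannot change the sign. *)
  have := hamiltonian_near hml hC1 hC2 hb_cvg hl_cvg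
    (continuous_Dx theta1 (x := _)) (continuous_Dt theta1 (x := _)) pi ha.
  apply: filterS => w hw /hw/(_ a); rewrite /= DtE DxE => hwa /sup_addr_le0/(_ a I).
  by move: hwa; rewrite ltr_norml => /andP[+ _]; lra.
have [e [q [e0 [Wt Wf] qT qmax]]] : exists e q, [/\ 0 < e, _, 0 < q.2 < T &
    local_max (u e \- theta) q] := relaxed_maxima (p := (x, t)) tT uusc ulim
    (C1fun_continuous phi1) umax (filterI (FW true) (FW false)).
case: q => y s in Wt Wf qT qmax *.
have [i clj h] := uside e e0 theta theta1 y s qT qmax.
have qi : dom Omega T i (y, s) by split=> //=; case/andP: qT => /ltW -> /ltW ->.
by case: i qi h {clj} => [/Wt|/Wf].
Qed.

(** The maxima are those of [- v e], which makes [theta] equal to [phi - sqdist]. A failing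
    inequality now fails by a margin [eta] for all controls at once, and half of it survives the
    perturbation. *)
Lemma limit_one_sided_super (v : R -> V * R -> R) (vbar : V * R -> R) :
  (forall e, 0 < e -> lsc_on (QT T) (v e)) ->
  (forall e, 0 < e -> one_sided_super (be e) (le e) (v e)) ->
  (forall q, QT T q -> (vbar q)%:E = liminf_star T v q) ->
  one_sided_super b l vbar /\ lsc_on (QT T) vbar.
Proof.
move=> vlsc vside vlim; pose u e := \- v e; pose ubar := \- vbar.
have ulim q : QT T q -> (ubar q)%:E = limsup_star T u q.
  move=> Tq; rewrite /ubar EFinN vlim // /liminf_star /limsup_star /limf_einf oppeK.
  by congr limf_esup.
have uusc e : 0 < e -> usc_on (QT T) (u e).
  move=> e0 q Tq eta eta0; move: (vlsc e e0 q Tq eta eta0).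
  by apply: (@filterS _ (within (QT T) (nbhs q))) => q' h; rewrite /u /=; lra.
split; last first.
  move=> q Tq eta eta0; move: (limsup_star_usc ulim Tq eta0).
  by apply: (@filterS _ (within (QT T) (nbhs q))) => q'; rewrite /ubar /=; lra.
move=> phi phi1 x t tT vmin; apply: contrapT => noside.
pose theta := \- (\- phi \+ sqdist (x, t)).
have phiN := C1funN phi1; have theta1' : C1fun (\- phi \+ sqdist (x, t)).
  exact: C1funD phiN (C1fun_sqdist _).
have theta1 : C1fun theta by exact: C1funN.
have DxE : Dx theta (x, t) = Dx phi (x, t).
  rewrite DxN // DxD ?Dx_sqdist ?subrr ?scaler0 ?addr0 ?DxN ?opprK //.
  exact: C1fun_sqdist.
have DtE : Dt theta (x, t) = Dt phi (x, t).
  rewrite DtN // DtD ?Dt_sqdist ?subrr ?mulr0 ?addr0 ?DtN ?opprK //.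
  exact: C1fun_sqdist.
have FW i : \forall w \near filter_prod 0^'+ (nbhs ((x, t) : V * R)),
    dom Omega T i w.2 -> ~ (0 <= (Dt theta w.2)%:E
      + Ham (be w.1) (le w.1) i w.2.1 w.2.2 (Dx theta w.2))%E.
  have [xi|xi] := pselect (closure (Omega i) x); last first.
    by apply: filterS (notin_closure_near t xi) => w + [].
  have [eta eta0 heta] : exists2 eta, 0 < eta & forall a : A i, setT a ->
      Dt phi (x, t) + (- dot (b x t a) (Dx phi (x, t)) - l x t a) <= - eta.
    by apply: sup_addr_ge0 => h; apply: noside; exists i.
  have pi : dom Omega T i (x, t) by split=> //=; case/andP: tT => /ltW -> /ltW ->.
  have eta2 : 0 < eta / 2 by rewrite divr_gt0.
  have := hamiltonian_near hml hC1 hC2 hb_cvg hl_cvg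
    (continuous_Dx theta1 (x := _)) (continuous_Dt theta1 (x := _)) pi eta2.
  apply: filterS => w hw /hw {}hw h.
  have : ((Dt theta w.2 + eta / 2)%:E
      + Ham (be w.1) (le w.1) i w.2.1 w.2.2 (Dx theta w.2) <= 0)%E.
    apply/sup_addr_le0 => a _; have := hw a; have := heta a I.
    by rewrite /= DtE DxE ltr_norml => ? /andP[_]; lra.
  (* Together with [h] the bound just proved would give [eta / 2 <= 0]; the order of addition
     matters since the Hamiltonian may be infinite. *)
  rewrite EFinD (addeC _ (eta / 2)%:E) -addeA => /(le_trans (leeD (lexx (eta / 2)%:E) h)).
  by rewrite adde0 lee_fin leNgt eta2.
have vmin' : local_max (ubar \- (\- phi)) (x, t).
  by apply: filterS vmin => q; rewrite /ubar /=; lra.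
have [e [q [e0 [Wt Wf] qT qmax]]] : exists e q, [/\ 0 < e, _, 0 < q.2 < T &
    local_max (u e \- (\- phi \+ sqdist (x, t))) q] := relaxed_maxima (p := (x, t)) tT uusc ulim
    (C1fun_continuous phiN) vmin' (filterI (FW true) (FW false)).
case: q => y s in Wt Wf qT qmax *.
have qmin : local_min (v e \- theta) (y, s).
  by apply: filterS qmax => q'; rewrite /u /theta /=; lra.
have [i clj h] := vside e e0 theta theta1 y s qT qmin.
have qi : dom Omega T i (y, s) by split=> //=; case/andP: qT => /ltW -> /ltW ->.
by case: i qi h {clj} => [/Wt|/Wf].
Qed.

End OneSided.

(** Convexity of the set of pairs yields a single control realizing both the averaged dynamics and
    the averaged cost. *)
Lemma convex_controls (R : realType) (N : nat) (Omega : bool -> set 'rV[R]_N) (T : R)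
    (A : bool -> metricType R)
    (b : forall i, 'rV[R]_N -> R -> A i -> 'rV[R]_N)
    (l : forall i, 'rV[R]_N -> R -> A i -> R) i z s (a1 a2 : A i) (k : R) :
  C3 Omega T b l -> dom Omega T i (z, s) -> 0 <= k <= 1 ->
  exists a : A i, b i z s a = (1 - k) *: b i z s a1 + k *: b i z s a2 /\
    l i z s a = (1 - k) * l i z s a1 + k * l i z s a2.
Proof.
move=> c3 zs /andP[k0 k1]; have [_ cvx] := c3 i z s zs.
have S (a : A i) : ((b i z s a, l i z s a) : convex_lmodType ('rV[R]_N * R^o)%type)
    \in bl_set b l i z s by apply/mem_set; exists a.
have /set_mem[a _ []] := cvx _ _ (Itv01 k0 k1) (S a2) (S a1).
by move=> eb el; exists a; rewrite eb el addrC [X in _ /\ X = _]addrC.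
Qed.

(** * Tangential controls under perturbation *)

Section Tangential.
Context {R : realType} {N : nat}.
Local Notation V := 'rV[R]_N.
Variables (Omega : bool -> set V) (H : set V) (n : bool -> V -> V) (T : R).
Hypothesis hOmega : H_Omega Omega H.
Hypothesis hn : forall i z, H z -> outward_unit_normal (Omega i) z (n i z).
Variables (A : bool -> metricType R).
Variables (b : forall i, V -> R -> A i -> V) (l : forall i, V -> R -> A i -> R).
Variables (be : R -> forall i, V -> R -> A i -> V)
  (le : R -> forall i, V -> R -> A i -> R).
Variables (Mb Lb Ml : R) (ml : R -> R).
Hypothesis hml : modulus ml.
Hypothesis hC1 : forall e, 0 < e -> C1 Omega T (be e) Mb Lb.
Hypothesis hC2 : forall e, 0 < e -> C2 Omega T (le e) Ml ml.
Hypothesis hC3 : forall e, 0 < e -> C3 Omega T (be e) (le e).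
Hypothesis hb_cvg : loc_unif_cvg_dynamics Omega T be b.
Hypothesis hl_cvg : loc_unif_cvg_costs Omega T le l.
Hypothesis hC4 : C4 H n T b.

Lemma chart_grad_cvg x r L psi : 0 < r ->
  interface_chart Omega H n x r L psi -> grad psi y @[y --> x] --> grad psi x.
Proof.
move=> r0 [_ Lpsi _ _ _]; apply: (@cvg_rV_enorm _ _ _ (nbhs x)) => eta eta0.
have cx : id @ nbhs x --> x by exact: cvg_id.
have cL : L * enorm (y - x) @[y --> x] --> L * 0.
  exact: (cvgM (@cvg_cst _ L _ (nbhs x) _) (cvg_enormB cx)).
have hL : \forall y \near x, L * enorm (y - x) < eta.
  by apply: (cvgr_lt _ cL); rewrite mulr0.
near=> y; apply: (@le_lt_trans _ _ (L * enorm (y - x))); last by near: y.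
apply: Lpsi; first by near: y; exact: enorm_nbhs.
by rewrite subrr enorm0.
Unshelve. all: by end_near. Qed.

(** The normal is prescribed pointwise; its continuity comes from the single [psi] of a chart, whose
    gradient is continuous and nonzero. *)
Lemma normal_near x eta : H x -> 0 < eta ->
  \forall y \near x, H y -> enorm (n true y - n true x) < eta.
Proof.
move=> Hx eta0; have [r [L [psi [r0 L0 ch]]]] := ex_interface_chart hOmega hn Hx.
have cg := chart_grad_cvg r0 ch; have [dpsi _ _ _ npsi] := ch.
have xr : enorm (x - x) < r by rewrite subrr enorm0.
have cu : unit_grad psi y @[y --> x] --> unit_grad psi x.
  have gx0 : enorm (grad psi x) != 0.
    by rewrite gt_eqF // enorm_gt0 //; case: (dpsi x xr).
  exact: (cvgZ (cvgV gx0 (cvg_enorm cg)) cg).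
have hd : \forall y \near x, enorm (unit_grad psi y - unit_grad psi x) < eta.
  exact: (cvgr_lt _ (cvg_enormB cu)).
near=> y => Hy; rewrite !npsi //; last by near: y; exact: enorm_nbhs.
by rewrite /side !scale1r; near: y.
Unshelve. all: by end_near. Qed.

Lemma normal_opp x : H x -> n false x = - n true x.
Proof.
move=> Hx; have [r [L [psi [r0 L0 [_ _ _ _ npsi]]]]] := ex_interface_chart hOmega hn Hx.
have xr : enorm (x - x) < r by rewrite subrr enorm0.
by rewrite !npsi // /side scale1r scaleN1r.
Qed.

Section AtInterfacePoint.
Variable p : V * R.
Hypothesis Hp : H p.1.
Hypothesis pT : 0 <= p.2 <= T.

Let D (q : V * R) := H q.1 /\ 0 <= q.2 <= T.

(** Normals are prescribed on [H] only, and only there do the dynamics of both sides apply at the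
    same point, so limits are taken along points of [D]. *)
Let F := within (fun w : R * (V * R) => D w.2) (filter_prod 0^'+ (nbhs p)).

Let FF : Filter F. Proof. exact: within_filter. Qed.

Let D_dom i q : D q -> dom Omega T i q.
Proof. by move=> [Hq qT]; split=> //; exact: (interface_closure hOmega). Qed.

Let Dp : D p. Proof. by []. Qed.

Let cvg_be i (a : A i) : be w.1 w.2.1 w.2.2 a @[w --> F] --> b p.1 p.2 a.
Proof.
apply: cvg_rV_enorm => eta eta0.
have := dynamics_near hC1 hb_cvg (D_dom i Dp) eta0.
by apply: filterS => w hw /(@D_dom i) /hw; exact.
Qed.

Let cvg_le i (a : A i) : le w.1 w.2.1 w.2.2 a @[w --> F] --> l p.1 p.2 a.
Proof.
apply/cvgrPdistC_lt => eta eta0.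
have := costs_near hml hC2 hl_cvg (D_dom i Dp) eta0.
by apply: filterS => w hw /(@D_dom i) /hw; exact.
Qed.

Let cvg_point (X : topologicalType) (f : V * R -> X) : {for p, continuous f} ->
  f w.2 @[w --> F] --> f p.
Proof.
move=> cf; rewrite /F; apply: cvg_within_filter.
have cq : snd @ filter_prod (0 : R)^'+ (nbhs p) --> p by exact: cvg_snd.
exact: (cvg_comp _ _ cq cf).
Qed.

Let cvg_normal : n true w.2.1 @[w --> F] --> n true p.1.
Proof.
apply: cvg_rV_enorm => eta eta0.
have cq : (fun w : R * (V * R) => w.2.1) @ filter_prod (0 : R)^'+ (nbhs p) --> p.1.
  have c2 : snd @ filter_prod (0 : R)^'+ (nbhs p) --> p by exact: cvg_snd.
  have c1 : fst @ nbhs p --> p.1 by exact: cvg_fst.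
  exact: (cvg_comp _ _ c2 c1).
have hN : \forall w \near filter_prod (0 : R)^'+ (nbhs p),
    H w.2.1 -> enorm (n true w.2.1 - n true p.1) < eta.
  exact: (cq _ (normal_near Hp eta0)).
by move: hN; apply: filterS => w hw [Hw _]; exact: hw.
Qed.

Let cvg_bH a : bH (be w.1) w.2.1 w.2.2 a @[w --> F] --> bH b p.1 p.2 a.
Proof. by apply: cvgD; apply: cvgZl_tmp; exact: cvg_be. Qed.

Let cvg_lH a : lH (le w.1) w.2.1 w.2.2 a @[w --> F] --> lH l p.1 p.2 a.
Proof.
by apply: cvgD; apply: cvgM; [exact: cvg_cst|exact: cvg_le
  |exact: cvg_cst|exact: cvg_le].
Qed.

(* Moving both controls towards controls [be1, be2] that push to the other side
   of the interface, with the same weight [k], restores the tangency lost by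
   perturbing the data; [k] tends to 0. *)
Let A0_near_half a (beta : A true * A false) (d : R) (G : V * R -> V) (c : V * R -> R) :
  A0 n b p.1 p.2 a -> d != 0 ->
  dot (bH b p.1 p.2 (beta, a.2)) (n true p.1) = d ->
  {for p, continuous G} -> {for p, continuous c} ->
  0 < c p - dot (bH b p.1 p.2 a) (G p) - lH l p.1 p.2 a ->
  \forall w \near F, dot (bH (be w.1) w.2.1 w.2.2 a) (n true w.2.1) * d <= 0 ->
    exists a', A0 n (be w.1) w.2.1 w.2.2 a' /\
      0 < c w.2 - dot (bH (be w.1) w.2.1 w.2.2 a') (G w.2) - lH (le w.1) w.2.1 w.2.2 a'.
Proof.
move=> [a01 a0] d0 bd cG cc val0.
pose beta' : A true * A false * R := (beta, a.2).
pose xi (w : R * (V * R)) := dot (bH (be w.1) w.2.1 w.2.2 a) (n true w.2.1).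
pose kap (w : R * (V * R)) := dot (bH (be w.1) w.2.1 w.2.2 beta') (n true w.2.1).
(* The root of [(1 - k) * xi + k * kap = 0]. As [kap] has the sign of [d] and [xi] does not, it lies
   in [[0, 1]]; it tends to 0 because [xi] does while [kap] tends to [d]. *)
pose k w := xi w / (xi w - kap w).
have cxi : xi w @[w --> F] --> 0 by rewrite -a0; apply: cvg_dot.
have ckap : kap w @[w --> F] --> d by rewrite -bd; apply: cvg_dot.
have ck : k w @[w --> F] --> 0 / (0 - d).
  apply: cvgM => //; apply: cvgV; first by rewrite sub0r oppr_eq0.
  exact: cvgB.
rewrite mul0r in ck.
pose B w := (1 - k w) *: bH (be w.1) w.2.1 w.2.2 a + k w *: bH (be w.1) w.2.1 w.2.2 beta'.
pose Lc w := (1 - k w) * lH (le w.1) w.2.1 w.2.2 a + k w * lH (le w.1) w.2.1 w.2.2 beta'.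
have c1k : 1 - k w @[w --> F] --> (1 : R) - 0 by apply: cvgB => //; exact: cvg_cst.
have cB : B w @[w --> F] --> bH b p.1 p.2 a.
  have := cvgD (cvgZ c1k (@cvg_bH a)) (cvgZ ck (@cvg_bH beta')).
  by rewrite subr0 scale1r scale0r addr0; apply.
have cLc : Lc w @[w --> F] --> lH l p.1 p.2 a.
  have := cvgD (cvgM c1k (@cvg_lH a)) (cvgM ck (@cvg_lH beta')).
  by rewrite subr0 mul1r mul0r addr0; apply.
have cval : c w.2 - dot (B w) (G w.2) - Lc w @[w --> F] -->
    c p - dot (bH b p.1 p.2 a) (G p) - lH l p.1 p.2 a.
  have cvc : c w.2 @[w --> F] --> c p by exact: cvg_point.
  have cd : dot (B w) (G w.2) @[w --> F] --> dot (bH b p.1 p.2 a) (G p).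
    by apply: cvg_dot => //; exact: cvg_point.
  exact: (cvgB (cvgB cvc cd) cLc).
have ckd : kap w * d @[w --> F] --> d * d by apply: cvgM => //; exact: cvg_cst.
have d2 : 0 < d * d by rewrite -expr2 exprn_even_gt0.
have e0 : \forall w \near F, 0 < w.1.
  have c1 : fst @ F --> (0 : R)^'+ by rewrite /F; apply: cvg_within_filter; exact: cvg_fst.
  exact: (c1 _ (nbhs_right_gt (0 : R))).
have DF : \forall w \near F, D w.2 by exact: withinT.
near=> w => xid.
have w0 : 0 < w.1 by near: w.
have Dw : D w.2 by near: w.
have kd : 0 < kap w * d by near: w; exact: (cvgr_gt _ ckd).
have vw : 0 < c w.2 - dot (B w) (G w.2) - Lc w by near: w; exact: (cvgr_gt _ cval).
rewrite -/(xi w) in xid.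
have hx : xi w - kap w != 0.
  apply/eqP => h; have : (xi w - kap w) * d = 0 by rewrite h mul0r.
  by rewrite mulrBl; lra.
have s0 : 0 < - (xi w * d) + kap w * d by lra.
have kE : k w * (- (xi w * d) + kap w * d) = - (xi w * d) by rewrite /k; field.
have k01 : 0 <= k w <= 1 by nra.
have [a1 [b1 l1]] := convex_controls a.1.1 beta.1 (hC3 w0) (D_dom true Dw) k01.
have [a2 [b2 l2]] := convex_controls a.1.2 beta.2 (hC3 w0) (D_dom false Dw) k01.
(* [a] and [beta'] share the weight [a.2], and for a fixed weight [bH] is linear in the pair of
   dynamics, so combining each side with the same [k] combines [bH]. *)
have BE : bH (be w.1) w.2.1 w.2.2 (a1, a2, a.2) = B w.
  rewrite /B /bH /= b1 b2; apply/rowP => j; rewrite !mxE /=; ring.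
have LE : lH (le w.1) w.2.1 w.2.2 (a1, a2, a.2) = Lc w.
  by rewrite /Lc /lH /= l1 l2; ring.
exists (a1, a2, a.2); rewrite BE LE; split=> //; split=> //.
rewrite BE /B dotDl !dotZl -/(xi w) -/(kap w) /k; field.
Unshelve. all: by end_near. Qed.

(** Both sides are measured along [n true]. Since [n false] is its opposite, side [false] uses
    [- d], which the symmetric interval of (C4) also contains. *)
Lemma normal_controls : exists2 delta, 0 < delta &
  forall d, - delta <= d <= delta -> forall i,
    exists a : A i, dot (b p.1 p.2 a) (n true p.1) = d.
Proof.
have [delta delta0 ctl] := hC4; exists delta => // d dd [].
  have [|a _ <-] := ctl true p.1 p.2 Hp pT d; first by rewrite /= in_itv /= dd.
  by exists a.
have [|a _ ad] := ctl false p.1 p.2 Hp pT (- d).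
  by rewrite /= in_itv /= lerN2 lerNl andbC.
by exists a; apply: oppr_inj; rewrite -ad (normal_opp Hp) dotNr.
Qed.

Lemma A0_nonempty : exists a, A0 n b p.1 p.2 a.
Proof.
have [delta delta0 ctl] := normal_controls.
have d0 : - delta <= 0 <= delta by rewrite oppr_le0 ltW.
have [[a1 h1] [a2 h2]] := (ctl 0 d0 true, ctl 0 d0 false).
exists (a1, a2, 0); split; first by rewrite /= lexx ler01.
by rewrite /bH /= dotDl !dotZl h1 h2 !mulr0 addr0.
Qed.

(** The sign of the normal defect of [a] under perturbed data varies with [w]; correctors of normal
    speed [delta] and [- delta] are both prepared, and one of them always opposes it. *)
Lemma A0_near a (G : V * R -> V) (c : V * R -> R) :
  A0 n b p.1 p.2 a -> {for p, continuous G} -> {for p, continuous c} ->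
  0 < c p - dot (bH b p.1 p.2 a) (G p) - lH l p.1 p.2 a ->
  \forall w \near filter_prod 0^'+ (nbhs p), H w.2.1 -> 0 <= w.2.2 <= T ->
    exists a', A0 n (be w.1) w.2.1 w.2.2 a' /\
      0 < c w.2 - dot (bH (be w.1) w.2.1 w.2.2 a') (G w.2) - lH (le w.1) w.2.1 w.2.2 a'.
Proof.
move=> Aa cG cc val0; have [delta delta0 ctl] := normal_controls.
have half d : - delta <= d <= delta -> d != 0 ->
    \forall w \near F, dot (bH (be w.1) w.2.1 w.2.2 a) (n true w.2.1) * d <= 0 ->
    exists a', A0 n (be w.1) w.2.1 w.2.2 a' /\
      0 < c w.2 - dot (bH (be w.1) w.2.1 w.2.2 a') (G w.2) - lH (le w.1) w.2.1 w.2.2 a'.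
  move=> dd d0; have [[a1 h1] [a2 h2]] := (ctl d dd true, ctl d dd false).
  apply: (@A0_near_half a (a1, a2) d) => //.
  by rewrite /bH /= dotDl !dotZl h1 h2; ring.
have dd : - delta <= delta <= delta by apply/andP; split; lra.
have dN : - delta <= - delta <= delta by apply/andP; split; lra.
have d0 : delta != 0 by rewrite gt_eqF.
have dN0 : - delta != 0 by rewrite oppr_eq0.
have hF : \forall w \near F, exists a', A0 n (be w.1) w.2.1 w.2.2 a' /\
      0 < c w.2 - dot (bH (be w.1) w.2.1 w.2.2 a') (G w.2) - lH (le w.1) w.2.1 w.2.2 a'.
  have := half _ dN dN0; have := half _ dd d0.
  apply: filterS2 => w; set xi := dot _ (n true w.2.1) => h1 h2.
  by have [xi0|xi0] := leP xi 0; [apply: h1|apply: h2]; nra.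
apply: (@filterS _ (filter_prod 0^'+ (nbhs p)) _ _ _ _ hF) => w hw Hw wT.
exact: hw.
Qed.

End AtInterfacePoint.

End Tangential.

(** [DH] and [Dx] differ by a multiple of the normal, which controls of [A0] annihilate. *)
Lemma dot_bH_DH (R : realType) (N : nat) (n : bool -> 'rV[R]_N -> 'rV[R]_N)
    (A : bool -> metricType R) (b : forall i, 'rV[R]_N -> R -> A i -> 'rV[R]_N)
    (z : 'rV[R]_N) (s : R) a (phi : 'rV[R]_N * R -> R) :
  A0 n b z s a ->
  dot (bH b z s a) (DH (n true) phi (z, s)) = dot (bH b z s a) (Dx phi (z, s)).
Proof. by move=> [_ ba]; rewrite /DH dotBr dotZr ba mulr0 subr0. Qed.

(** * The tangential inequality at interior times *)

Section TangentialLimit.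
Context {R : realType} {N : nat}.
Local Notation V := 'rV[R]_N.
Variables (Omega : bool -> set V) (H : set V) (n : bool -> V -> V) (T : R).
Hypothesis hOmega : H_Omega Omega H.
Hypothesis hn : forall i z, H z -> outward_unit_normal (Omega i) z (n i z).
Variables (A : bool -> metricType R).
Variables (b : forall i, V -> R -> A i -> V) (l : forall i, V -> R -> A i -> R).
Variables (be : R -> forall i, V -> R -> A i -> V)
  (le : R -> forall i, V -> R -> A i -> R).
Variables (Mb Lb Ml : R) (ml : R -> R).
Hypothesis hml : modulus ml.
Hypothesis hC1 : forall e, 0 < e -> C1 Omega T (be e) Mb Lb.
Hypothesis hC2 : forall e, 0 < e -> C2 Omega T (le e) Ml ml.
Hypothesis hC3 : forall e, 0 < e -> C3 Omega T (be e) (le e).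
Hypothesis hb_cvg : loc_unif_cvg_dynamics Omega T be b.
Hypothesis hl_cvg : loc_unif_cvg_costs Omega T le l.
Hypothesis hC4 : C4 H n T b.

(* Outside the interface the penalty [C * |psi|] makes the Hamiltonian too
   large, since some control pushes towards the interface at positive speed. *)
Lemma controls_near i (x : V) (t r L : R) (psi : V -> R) (delta : R)
    (theta : V * R -> R) :
  H x -> 0 <= t <= T -> 0 < r -> interface_chart Omega H n x r L psi ->
  0 < delta -> (exists a, dot (b x t (a : A i)) (n i x) = delta) -> C1fun theta ->
  exists K delta', [/\ 0 < K, 0 < delta' &
  \forall w \near filter_prod 0^'+ (nbhs ((x, t) : V * R)), dom Omega T i w.2 ->
   exists a : A i, - K < Dt theta w.2 +
      (- dot (be w.1 w.2.1 w.2.2 a) (Dx theta w.2) - le w.1 w.2.1 w.2.2 a) /\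
     delta' < side R i * dot (be w.1 w.2.1 w.2.2 a) (grad psi w.2.1)].
Proof.
move=> Hx tT r0 ch delta0 [a ad] theta1; pose p : V * R := (x, t).
have pi : dom Omega T i p by split=> //; exact: (interface_closure hOmega).
have [dpsi _ _ _ npsi] := ch.
have xr : enorm (x - x) < r by rewrite subrr enorm0.
have [_ g0] := dpsi x xr; have gpos := enorm_gt0 g0.
pose v := Dt theta p + (- dot (b x t a) (Dx theta p) - l x t a).
pose F := within (fun w : R * (V * R) => dom Omega T i w.2) (filter_prod 0^'+ (nbhs p)).
have FF : Filter F by exact: within_filter.
have cbe : be w.1 w.2.1 w.2.2 a @[w --> F] --> b x t a.
  apply: cvg_rV_enorm => eta eta0.
  have := dynamics_near hC1 hb_cvg pi eta0.
  by apply: filterS => w hw /hw; exact.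
have cg : grad psi w.2.1 @[w --> F] --> grad psi x.
  rewrite /F; apply: cvg_within_filter.
  have c2 : snd @ filter_prod (0 : R)^'+ (nbhs p) --> p by exact: cvg_snd.
  have c1 : fst @ nbhs p --> x by exact: cvg_fst.
  exact: (cvg_comp _ _ (cvg_comp _ _ c2 c1) (chart_grad_cvg r0 ch)).
have cs : side R i * dot (be w.1 w.2.1 w.2.2 a) (grad psi w.2.1) @[w --> F] -->
    side R i * dot (b x t a) (grad psi x).
  by apply: cvgM; [exact: cvg_cst|exact: cvg_dot].
(* [n i x] is [side i] times the unit gradient, so leaving [Omega i] at normal speed [delta] means
   that [side i * psi], negative inside, grows at this rate. *)
have sE : side R i * dot (b x t a) (grad psi x) = enorm (grad psi x) * delta.
  rewrite -ad npsi // dotZr (dotC _ (grad psi x)) grad_unit_grad //.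
  by rewrite (dotC _ (b x t a)); ring.
(* Half of the limiting speed, and a lower bound on the value that allows an error of 1 around
   [v]. *)
exists (`|v| + 1), (enorm (grad psi x) * delta / 2).
have s0 : 0 < enorm (grad psi x) * delta by rewrite mulr_gt0.
split; [by rewrite ltr_wpDl|by rewrite divr_gt0|].
have h1 : \forall w \near filter_prod (0 : R)^'+ (nbhs p), dom Omega T i w.2 ->
    enorm (grad psi x) * delta / 2 <
    side R i * dot (be w.1 w.2.1 w.2.2 a) (grad psi w.2.1).
  apply: (@cvgr_gt _ _ F _ _ _ cs).
  by rewrite sE ltr_pdivrMr // ltr_pMr // ltr1n.
have h2 := hamiltonian_near hml hC1 hC2 hb_cvg hl_cvg
    (continuous_Dx theta1 (x := p)) (continuous_Dt theta1 (x := p)) pi ltr01.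
move: h1 h2; apply: filterS2 => w h1 h2 wi; exists a; split; last exact: h1.
move: (h2 wi a); rewrite ltr_norml -/v => /andP[+ _].
by have := ler_norm (- v); rewrite normrN; lra.
Qed.

Lemma tangential_limit (u : R -> V * R -> R) (ubar : V * R -> R) :
  (forall e, 0 < e ->
    subsolution Omega H n T (be e) (le e) [set` `]0, T[] (u e)) ->
  bounded_on (QT T) ubar ->
  (forall p, QT T p -> (ubar p)%:E = limsup_star T u p) ->
  tangential_subsolution H n b l [set` `]0, T[] ubar.
Proof.
move=> usub [Mbar ubarM] ulim phi phi1 x t Hx; rewrite /= in_itv /= => tT pmax.
pose p : V * R := (x, t).
have tT' : 0 <= t <= T by case/andP: tT => /ltW -> /ltW ->.
apply/sup_addr_le0 => a Aa; rewrite leNgt; apply/negP; rewrite dot_bH_DH // => val0.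
pose theta := phi \+ sqdist p.
have theta1 : C1fun theta by exact: C1funD phi1 (C1fun_sqdist _).
have DxE : Dx theta p = Dx phi p.
  by rewrite DxD ?Dx_sqdist ?subrr ?scaler0 ?addr0 //; exact: C1fun_sqdist.
have DtE : Dt theta p = Dt phi p.
  by rewrite DtD ?Dt_sqdist ?subrr ?mulr0 ?addr0 //; exact: C1fun_sqdist.
have hA0 := A0_near hOmega hn hml hC1 hC2 hC3 hb_cvg hl_cvg hC4 (p := p) Hx tT'
  Aa (continuous_Dx theta1 (x := p)) (continuous_Dt theta1 (x := p)).
have {hA0}/hA0 hA0 : 0 < Dt theta p - dot (bH b p.1 p.2 a) (Dx theta p) - lH l p.1 p.2 a.
  by rewrite DxE DtE; move: val0; rewrite addrA.
have [r [L [psi [r0 L0 ch]]]] := ex_interface_chart hOmega hn Hx.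
have [dpsi Lpsi zpsi spsi npsi] := ch.
have xr : enorm (x - x) < r by rewrite subrr enorm0.
have [delta delta0 ctl] := hC4.
have ctl' i : exists a, dot (b x t (a : A i)) (n i x) = delta.
  have [|a' _ h] := ctl i x t Hx tT' delta; last by exists a'.
  by rewrite /= in_itv /= lexx andbT; lra.
have [K1 [d1 [K10 d10 ctl1]]] :=
  controls_near (i := true) Hx tT' r0 ch delta0 (ctl' true) theta1.
have [K2 [d2 [K20 d20 ctl2]]] :=
  controls_near (i := false) Hx tT' r0 ch delta0 (ctl' false) theta1.
have rnear : \forall w \near filter_prod (0 : R)^'+ (nbhs p), enorm (w.2.1 - x) < r.
  have c2 : snd @ filter_prod (0 : R)^'+ (nbhs p) --> p by exact: cvg_snd.
  have c1 : fst @ nbhs p --> x by exact: cvg_fst.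
  exact: (cvg_comp _ _ c2 c1 _ (enorm_nbhs x r0)).
have pnear : \forall q \near p, enorm (q.1 - x) < r.
  have c1 : fst @ nbhs p --> x by exact: cvg_fst.
  exact: (c1 _ (enorm_nbhs x r0)).
pose P (q : V * R) := `|psi q.1|.
have uusc e : 0 < e -> usc_on (QT T) (u e) by case/usub => -[].
have Pp0 : P p = 0 by rewrite /P (zpsi x xr).1 ?normr0.
have Pcont : \forall q \near p, {for q, continuous P}.
  near=> q; have qr : enorm (q.1 - x) < r by near: q.
  have c1 : fst @ nbhs q --> q.1 by exact: cvg_fst.
  have cpsi : psi @ nbhs q.1 --> psi q.1.
    by apply: differentiable_continuous; case: (dpsi q.1 qr).
  exact: (cvg_norm (cvg_comp _ _ c1 cpsi)).
have Pmax : \forall q \near p, P q = 0 -> ubar q - phi q <= ubar p - phi p.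
  near=> q => /eqP; rewrite normr_eq0 => /eqP psi0.
  have qr : enorm (q.1 - x) < r by near: q.
  have qT : 0 < q.2 < T by near: q; exact: open_time_itv.
  have := pmax q.1 q.2; rewrite -surjective_pairing; apply.
    exact: (zpsi q.1 qr).2.
  by rewrite /= in_itv.
have [C0 HC0] := penalized_maxima (p := p) tT uusc ulim (C1fun_continuous phi1)
  (fun q => normr_ge0 _) Pp0 Pcont Pmax (filterI (filterI ctl1 ctl2) (filterI rnear hA0)).
(* [K1], [d1], [K2], [d2] and the neighborhood come from [theta] alone, so [C] may be chosen after
   them. *)
have [C [CC0 C0' CK1 CK2]] : exists C, [/\ C0 <= C, 0 <= C, K1 <= C * d1 & K2 <= C * d2].
  have h0 : 0 <= `|C0| + K1 / d1 + K2 / d2 by rewrite !addr_ge0 // divr_ge0 // ltW.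
  exists (`|C0| + K1 / d1 + K2 / d2); split=> //.
  - by rewrite -addrA ler_wpDr ?ler_norm // addr_ge0 // divr_ge0 // ltW.
  - rewrite -ler_pdivrMr // addrAC lerDr addr_ge0 // divr_ge0 // ltW //.
  - rewrite -ler_pdivrMr // lerDr addr_ge0 // divr_ge0 // ltW //.
have [e [[y s] [e0 [[Wt Wf] [/= yr WA0]] /= sT qmax]]] := HC0 C CC0.
pose q : V * R := (y, s); have sT' : 0 <= s <= T by case/andP: sT => /ltW -> /ltW ->.
have [[[MM uM] _] uint _ utan] := usub e e0.
have PE i z : enorm (z - x) < r -> Omega i z -> `|psi z| = - (side R i * psi z).
  move=> zr Oz; have := spsi i z zr Oz; rewrite /side; case: (i).
    by rewrite mul1r => /ltr0_norm.
  by rewrite mulN1r opprK oppr_lt0 => /gtr0_norm.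
have side1 i : `|side R i| = 1 by case: i; rewrite /side ?normrN normr1.
have notin i (K d : R) : K <= C * d -> (exists a : A i,
      - K < Dt theta q + (- dot (be e y s a) (Dx theta q) - le e y s a) /\
      d < side R i * dot (be e y s a) (grad psi y)) -> ~ Omega i y.
  move=> CK [c [Kc dc]] Oy.
  (* [lin] is, up to a constant, the linearization at [y] of [C * |psi|], which is
     [- C * side i * psi] in [Omega i]; [quad] dominates the remainder by [quadratic_bound] and has
     zero gradient at [q]. *)
  pose lin (q' : V * R) := (- side R i * C) * dot (grad psi y) q'.1.
  pose quad (q' : V * R) := (C * L) * sqdist q q'.
  have lin1 : C1fun lin by exact: C1funZ (C1fun_dot _).
  have quad1 : C1fun quad by exact: C1funZ (C1fun_sqdist _).
  pose Theta := (fun q' : V * R => theta q' + (fun q' => lin q' + quad q') q').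
  have lq1 : C1fun (fun q' => lin q' + quad q') by exact: C1funD.
  have Theta1 : C1fun Theta by exact: C1funD.
  have DxT : Dx Theta q = Dx theta q + (- side R i * C) *: grad psi y.
    rewrite (DxD q theta1 lq1) (DxD q lin1 quad1) (DxZ _ _ (C1fun_dot _)) Dx_dot.
    by rewrite (DxZ _ _ (C1fun_sqdist _)) Dx_sqdist subrr !scaler0 addr0.
  have DtT : Dt Theta q = Dt theta q.
    rewrite (DtD q theta1 lq1) (DtD q lin1 quad1) (DtZ _ _ (C1fun_dot _)) Dt_dot.
    by rewrite (DtZ _ _ (C1fun_sqdist _)) Dt_sqdist subrr !mulr0 !addr0.
  have maxT : local_max (u e \- Theta) q.
    have oO : open (Omega i) by case: hOmega.
    have c1 : fst @ nbhs q --> y by exact: cvg_fst.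
    have Onear : \forall q' \near q, Omega i q'.1.
      exact: (c1 _ (open_nbhs_nbhs (conj oO Oy))).
    have rnear' : \forall q' \near q, enorm (q'.1 - x) < r.
      exact: (c1 _ (enorm_open yr)).
    have qmax' : \forall q' \near q, u e q' - (phi q' + sqdist p q' + C * P q')
        <= u e q - (phi q + sqdist p q + C * P q) by exact: qmax.
    near=> q'.
    have q'r : enorm (q'.1 - x) < r by near: q'.
    have q'O : Omega i q'.1 by near: q'.
    have : u e q' - (phi q' + sqdist p q' + C * P q')
        <= u e q - (phi q + sqdist p q + C * P q) by near: q'.
    rewrite /P /= (PE _ _ q'r q'O) (PE _ _ yr Oy).
    have := quadratic_bound (fun z zr => (dpsi z zr).1) Lpsi L0 yr q'r.
    have : enorm (q'.1 - y) ^+ 2 <= sqdist q q'.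
      by rewrite sqr_enorm /sqdist /= lerDl sqr_ge0.
    move=> /(ler_wpM2l L0) h1 /le_trans /(_ h1).
    rewrite /Theta /theta /lin /quad /= sqdistxx mulr0 addr0 dotBr.
    move=> h2 h3.
    have : C * - (side R i *
        (psi q'.1 - psi y - (dot (grad psi y) q'.1 - dot (grad psi y) y)))
        <= C * (L * sqdist q q').
      rewrite ler_wpM2l //; apply: le_trans h2; apply: le_trans (ler_norm _) _.
      by rewrite normrN normrM side1 mul1r.
    move: h3; lra.
  have /sup_addr_le0/(_ c I) := uint i Theta Theta1 y s Oy sT maxT.
  (* The penalty contributes at least [C * d >= K], while the remaining terms exceed [- K]: the sum
     is positive. *)
  rewrite -/q DxT DtT dotDr dotZr leNgt => /negP; apply.
  have d0 : C * d <= C * (side R i * dot (be e y s c) (grad psi y)).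
    by rewrite ler_wpM2l // ltW.
  move: Kc; lra.
have qdom i : closure (Omega i) y -> dom Omega T i (y, s) by [].
have [Oy|Oy|Hy] := space_cover hOmega y.
- exact: (notin true K1 d1 CK1 (Wt (qdom true (subset_closure Oy))) Oy).
- exact: (notin false K2 d2 CK2 (Wf (qdom false (subset_closure Oy))) Oy).
have [a' [Aa' val']] := WA0 Hy sT'.
have [rho rho0 Hrho] : exists2 rho, 0 < rho & forall q', sqdist q q' <= rho ->
    u e q' - (phi q' + sqdist p q' + C * P q')
      <= u e q - (phi q + sqdist p q + C * P q) /\ enorm (q'.1 - x) < r.
  have c1 : fst @ nbhs q --> y by exact: cvg_fst.
  by apply: nbhs_sqdist; apply: filterI; [exact: qmax|exact: (c1 _ (enorm_open yr))].
have MM0 : 0 <= MM by apply: le_trans (uM p _); [exact: normr_ge0|exact: tT'].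
have Mbar0 : 0 <= Mbar by apply: le_trans (ubarM p _); [exact: normr_ge0|exact: tT'].
(* Beyond [rho], [quad] must beat all variations. [phi] may be unbounded, but the maximum of
   [ubar - phi] at [p] bounds [- phi q'] by [2 * Mbar - phi p]; [2 * MM] covers [u e]. Within [rho],
   both points lie on [H] and the penalty [C * P] vanishes. *)
pose Lam := (2 * MM + 2 * Mbar + `|theta q - phi p|) / rho.
have Lam0 : 0 <= Lam by rewrite divr_ge0 ?(ltW rho0) // !addr_ge0 ?mulr_ge0.
pose quad (q' : V * R) := Lam * sqdist q q'.
have quad1 : C1fun quad by exact: C1funZ (C1fun_sqdist _).
pose Theta (q' : V * R) := theta q' + quad q'.
have Theta1 : C1fun Theta by exact: C1funD.
have DxT : Dx Theta q = Dx theta q.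
  rewrite (DxD q theta1 quad1) (DxZ _ _ (C1fun_sqdist _)) Dx_sqdist subrr.
  by rewrite !scaler0 addr0.
have DtT : Dt Theta q = Dt theta q.
  rewrite (DtD q theta1 quad1) (DtZ _ _ (C1fun_sqdist _)) Dt_sqdist subrr.
  by rewrite !mulr0 addr0.
have Ty : Theta q = theta q by rewrite /Theta /quad sqdistxx mulr0 addr0.
have /sup_addr_le0/(_ a' Aa') : ((Dt Theta (y, s))%:E
    + HT n (be e) (le e) y s (DH (n true) Theta (y, s)) <= 0)%E.
  apply: (utan Theta Theta1 y s Hy); first by rewrite /= in_itv.
  move=> z tau Hz; rewrite /= in_itv /= => tauT.
  have tauT' : 0 <= tau <= T by case/andP: tauT => /ltW -> /ltW ->.
  pose q' : V * R := (z, tau); rewrite -/q -/q' Ty.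
  have [near|far] := leP (sqdist q q') rho.
    have [h zr] := Hrho q' near; move: h.
    rewrite /P (zpsi z zr).1 // (zpsi y yr).1 // normr0 !mulr0 !addr0.
    have : 0 <= quad q' by rewrite mulr_ge0 // sqdist_ge0.
    by rewrite /Theta /theta /=; lra.
  have hL : 2 * MM + 2 * Mbar + `|theta q - phi p| <= quad q'.
    rewrite -[leLHS](divfK (lt0r_neq0 rho0)) -/Lam.
    by rewrite ler_wpM2l // ltW.
  have := uM q' tauT'; have := uM q sT'; rewrite !ler_norml => /andP[h1 _] /andP[_ h2].
  have := ubarM p tT'; have := ubarM q' tauT'; rewrite !ler_norml => /andP[h3 _] /andP[_ h4].
  have h5 : ubar q' - phi q' <= ubar p - phi p.
    by apply: pmax => //; rewrite /= in_itv.
  have h6 := sqdist_ge0 p q'; have := ler_norm (theta q - phi p).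
  have -> : Theta q' = phi q' + sqdist p q' + quad q' by [].
  by move: hL; lra.
rewrite dot_bH_DH // -/q DxT DtT leNgt => /negP; apply.
by move: val'; rewrite addrA.
Unshelve. all: by end_near. Qed.

End TangentialLimit.

(** * The tangential inequality on the closed time interval *)

Section ClosedTimeInterval.
Context {R : realType} {N : nat}.
Local Notation V := 'rV[R]_N.
Variables (Omega : bool -> set V) (H : set V) (n : bool -> V -> V) (T : R).
Hypothesis hOmega : H_Omega Omega H.
Hypothesis hn : forall i z, H z -> outward_unit_normal (Omega i) z (n i z).
Hypothesis hT : 0 < T.
Variables (A : bool -> metricType R).
Variables (b : forall i, V -> R -> A i -> V) (l : forall i, V -> R -> A i -> R).
Variables (be : R -> forall i, V -> R -> A i -> V)
  (le : R -> forall i, V -> R -> A i -> R).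
Variables (Mb Lb Ml : R) (ml : R -> R).
Hypothesis hml : modulus ml.
Hypothesis hC1 : forall e, 0 < e -> C1 Omega T (be e) Mb Lb.
Hypothesis hC2 : forall e, 0 < e -> C2 Omega T (le e) Ml ml.
Hypothesis hC3 : forall e, 0 < e -> C3 Omega T (be e) (le e).
Hypothesis hb_cvg : loc_unif_cvg_dynamics Omega T be b.
Hypothesis hl_cvg : loc_unif_cvg_costs Omega T le l.
Hypothesis hC4 : C4 H n T b.

Lemma bH_bound e z s a : 0 < e -> H z -> 0 <= s <= T -> 0 <= a.2 <= 1 ->
  enorm (bH (be e) z s a) <= `|Mb|.
Proof.
move=> e0 Hz sT /andP[a0 a1]; apply: le_trans (ler_norm Mb).
have bound i c : enorm (be e z s (c : A i)) <= Mb.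
  have [_ _ bM _] := hC1 e0 i; apply: bM; split=> //.
  exact: (interface_closure hOmega).
apply: le_trans (ler_enormD _ _) _; rewrite !enormZ !ger0_norm ?subr_ge0 //.
have := bound true a.1.1; have := bound false a.1.2; nra.
Qed.

Lemma lH_bound e z s a : 0 < e -> H z -> 0 <= s <= T -> 0 <= a.2 <= 1 ->
  lH (le e) z s a <= `|Ml|.
Proof.
move=> e0 Hz sT /andP[a0 a1]; apply: le_trans (ler_norm Ml).
have bound i c : le e z s (c : A i) <= Ml.
  have [_ lM _] := hC2 e0 i; apply: le_trans (ler_norm _) _; apply: lM; split=> //.
  exact: (interface_closure hOmega).
rewrite /lH; have := bound true a.1.1; have := bound false a.1.2; nra.
Qed.

(* At t = 0 the test functions C t + K |(y, s) - (x, 0)|^2 with C large violate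
   the tangential inequality wherever A0 is nonempty. *)
Lemma closed_time_absurd (u : R -> V * R -> R) x : H x ->
  (forall e, 0 < e ->
    subsolution Omega H n T (be e) (le e) [set` `[0, T]] (u e)) -> False.
Proof.
move=> Hx usub; pose p : V * R := (x, 0).
have pT : 0 <= p.2 <= T by rewrite lexx ltW.
have [a Aa] := A0_nonempty hOmega hn hC4 (p := p) Hx pT.
(* Only the nonemptiness of the perturbed [A0] is wanted: with [G = 0] and the constant [c] below,
   the positivity premise of [A0_near] reads [0 < 1]. *)
have cG : {for p, continuous (fun=> 0 : V)} by exact: cst_continuous.
have cc : {for p, continuous (fun=> 1 + lH l p.1 p.2 a)} by exact: cst_continuous.
have := A0_near hOmega hn hml hC1 hC2 hC3 hb_cvg hl_cvg hC4 (p := p) Hx pT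
  Aa cG cc.
rewrite dot0r subr0 addrK => /(_ ltr01)[[E Q] /= [E0 Qp] EQ].
have [e [Ee e0]] : exists e, E e /\ 0 < e.
  by apply: (@filter_ex _ 0^'+); apply: filterI => //; exact: nbhs_right_gt.
have [rho rho0 Hrho] := nbhs_sqdist Qp.
have {Hrho}nonempty q : sqdist p q <= rho -> H q.1 -> 0 <= q.2 <= T ->
    exists a', A0 n (be e) q.1 q.2 a'.
  move=> qrho Hq qT; have [|a' [Aa' _]] := EQ (e, q) _ Hq qT; last by exists a'.
  by split=> //; exact: Hrho.
have [[[M uM] uusc] _ _ utan] := usub e e0.
(* Beyond [rho] the quadratic term exceeds the oscillation [2 * |M|] of [u e], so the maximum over
   the compact [S] is one over all of [H] and [[0, T]]. *)
pose K := (2 * `|M| + 1) / rho.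
have K0 : 0 <= K by rewrite /K divr_ge0 ?(ltW rho0) // addr_ge0 ?mulr_ge0.
(* Speed times a bound on the spatial gradient of [quad] where [sqdist p q <= rho], plus a bound on
   the cost, plus 1 for strictness. *)
pose C := `|Mb| * (2 * K * (rho + 1)) + `|Ml| + 1.
have C0 : 0 <= C.
  have h : 0 <= 2 * K * (rho + 1) by apply: mulr_ge0; [exact: mulr_ge0|lra].
  by have := mulr_ge0 (normr_ge0 Mb) h; have := normr_ge0 Ml; rewrite /C; lra.
pose quad (q : V * R) := K * sqdist p q; pose lin (q : V * R) := C * q.2.
have quad1 : C1fun quad by exact: C1funZ (C1fun_sqdist _).
have lin1 : C1fun lin by exact: C1funZ C1fun_time.
pose phi (q : V * R) := quad q + lin q; have phi1 : C1fun phi by exact: C1funD.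
pose S := [set q : V * R | sqdist p q <= rho] `&`
  ([set q | H q.1] `&` ([set q | 0 <= q.2] `&` [set q | q.2 <= T])).
have cS : compact S.
  apply: (subclosed_compact _ (@compact_sqdist_le _ _ p rho)); last by move=> q [].
  apply: closedI; first exact: closed_sqdist_le.
  apply: closedI.
    apply: (@closed_comp _ _ fst H); last exact: (closed_interface hOmega).
    by move=> q _; exact: cvg_fst.
  apply: closedI.
    apply: (@closed_comp _ _ (snd : V * R -> R) [set s | 0 <= s]); last exact: closed_ge.
    by move=> q _; exact: cvg_snd.
  apply: (@closed_comp _ _ (snd : V * R -> R) [set s | s <= T]); last exact: closed_le.
  by move=> q _; exact: cvg_snd.
have Sp : S p by split; [rewrite /= sqdistxx ltW|split=> //; split=> //=; exact: ltW].
have STq q : S q -> QT T q by move=> [_ [_ [/= h1 h2]]]; rewrite /QT /= h1 h2.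
have [q Sq qmax] : exists2 q, S q & forall q', S q' -> u e q' - phi q' <= u e q - phi q.
  apply: (compact_usc_max (f := fun q => u e q - phi q)) => //; first by exists p.
  move=> q c Sq qc; pose d := (c - (u e q - phi q)) / 2.
  have d0 : 0 < d by rewrite divr_gt0 // subr_gt0.
  have := uusc q (STq q Sq) d d0.
  have : \forall q' \near q, phi q - d < phi q'.
    by apply: (cvgr_gt _ (C1fun_continuous phi1 (x := q))); rewrite ltrBlDr ltrDl.
  apply: filterS2 => q' phiq' uq' Sq'; move: (uq' (STq q' Sq')) phiq'.
  by rewrite /d; lra.
have [qrho [Hq [q0 qT]]] := Sq; rewrite /= in qrho Hq q0 qT.
have qT' : 0 <= q.2 <= T by rewrite q0 qT.
have [a' Aa'] := nonempty q qrho Hq qT'.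
(* Wherever the maximum lies in [[0, T]], the time derivative of [phi] is at least [C], because [p]
   sits at time 0 and [quad] contributes [K * (2 * q.2) >= 0]. *)
have /sup_addr_le0/(_ a' Aa') : ((Dt phi (q.1, q.2))%:E
    + HT n (be e) (le e) q.1 q.2 (DH (n true) phi (q.1, q.2)) <= 0)%E.
  apply: (utan phi phi1 q.1 q.2 Hq); first by rewrite /= in_itv.
  move=> z tau Hz; rewrite /= in_itv /= => /andP[tau0 tauT].
  rewrite -surjective_pairing; pose q' : V * R := (z, tau); rewrite -/q'.
  have [near|far] := leP (sqdist p q') rho; first by apply: qmax; do !split.
  apply: le_trans (qmax p Sp); have q'T : QT T q' by rewrite /QT /= tau0 tauT.
  have := uM q' q'T; have := uM p pT; rewrite !ler_norml => /andP[h1 _] /andP[_ h2].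
  have h3 : 2 * `|M| + 1 <= K * sqdist p q'.
    rewrite -[leLHS](divfK (lt0r_neq0 rho0)) -/K.
    by rewrite ler_wpM2l // ltW.
  have h4 : 0 <= C * tau by rewrite mulr_ge0.
  rewrite /phi /quad /lin /= sqdistxx !mulr0 addr0 subr0.
  by have := ler_norm M; lra.
have [a01 _] := Aa'; rewrite dot_bH_DH // -surjective_pairing.
rewrite (DxD q quad1 lin1) (DtD q quad1 lin1) (DxZ _ _ (C1fun_sqdist _)).
rewrite (DtZ _ _ (C1fun_sqdist _)) (DxZ _ _ C1fun_time) (DtZ _ _ C1fun_time).
rewrite Dx_time Dt_time Dx_sqdist Dt_sqdist scaler0 addr0 mulr1 subr0 !dotZr.
set y := q.1 - p.1; have yrho : enorm y <= rho + 1.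
  have : enorm y ^+ 2 <= rho.
    by apply: le_trans qrho; rewrite sqr_enorm /sqdist lerDl sqr_ge0.
  have := enorm_ge0 y; nra.
have h1 : dot (bH (be e) q.1 q.2 a') y <= `|Mb| * (rho + 1).
  apply: le_trans (ler_norm _) _; apply: le_trans (dot_enorm _ _) _.
  by apply: ler_pM; rewrite ?enorm_ge0 // bH_bound.
have h2 : lH (le e) q.1 q.2 a' <= `|Ml| by rewrite lH_bound.
have h3 : 0 <= K * (2 * q.2) by apply: mulr_ge0 => //; exact: mulr_ge0.
have h4 := ler_wpM2l K0 h1; rewrite leNgt; apply/negP/negPn.
by rewrite /C; lra.
Qed.

End ClosedTimeInterval.

Unset Implicit Arguments.

Theorem theorem5p1 (R : realType) (N : nat) (hN : (0 < N)%N)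
    (Omega : bool -> set 'rV[R]_N) (H : set 'rV[R]_N)
    (hOmega : H_Omega Omega H)
    (n : bool -> 'rV[R]_N -> 'rV[R]_N)
    (hn : forall i z, H z -> outward_unit_normal (Omega i) z (n i z))
    (T : R) (hT : 0 < T)
    (A : bool -> metricType R)
    (b : forall i : bool, 'rV[R]_N -> R -> A i -> 'rV[R]_N)
    (l : forall i : bool, 'rV[R]_N -> R -> A i -> R)
    (g : 'rV[R]_N -> R)
    (be : R -> forall i : bool, 'rV[R]_N -> R -> A i -> 'rV[R]_N)
    (le : R -> forall i : bool, 'rV[R]_N -> R -> A i -> R)
    (ge : R -> 'rV[R]_N -> R)
    (Mb Lb Ml : R) (ml : R -> R) (hml : modulus ml)
    (hC1 : forall e : R, 0 < e -> C1 Omega T (be e) Mb Lb)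
    (hC2 : forall e : R, 0 < e -> C2 Omega T (le e) Ml ml)
    (hC3 : forall e : R, 0 < e -> C3 Omega T (be e) (le e))
    (hg : bounded_continuous g)
    (hge : forall e : R, 0 < e -> bounded_continuous (ge e))
    (hb_cvg : loc_unif_cvg_dynamics Omega T be b)
    (hl_cvg : loc_unif_cvg_costs Omega T le l)
    (hg_cvg : loc_unif_cvg ge g) :
  (* (i) *)
  (forall (v : R -> 'rV[R]_N * R -> R) (vbar : 'rV[R]_N * R -> R),
     (forall e : R, 0 < e -> supersolution Omega H T (be e) (le e) (v e)) ->
     bounded_on (QT T) vbar ->
     (forall p, QT T p -> (vbar p)%:E = liminf_star T v p) ->
     supersolution Omega H T b l vbar)
  /\
  (* (ii); J is the set of times at which the tangential inequality holds *)
  (forall (J : set R) (u : R -> 'rV[R]_N * R -> R) (ubar : 'rV[R]_N * R -> R),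
     J = [set` `[0, T]] \/ J = [set` `]0, T[] ->
     (forall e : R, 0 < e -> subsolution Omega H n T (be e) (le e) J (u e)) ->
     C4 H n T b ->
     bounded_on (QT T) ubar ->
     (forall p, QT T p -> (ubar p)%:E = limsup_star T u p) ->
     subsolution Omega H n T b l J ubar).
Proof.
split=> [v vbar vsuper vb vlim|J u ubar hJ usub hC4 ub ulim].
  have [] := limit_one_sided_super hml hC1 hC2 hb_cvg hl_cvg (v := v) (vbar := vbar).
  - by move=> e /vsuper[[]].
  - by move=> e /vsuper; exact: supersolution_one_sided.
  - exact: vlim.
  by move=> vside vlsc; exact: one_sided_supersolution.
apply: one_sided_subsolution => //.
- exact: limsup_star_usc ulim.
- apply: (limit_one_sided_sub hml hC1 hC2 hb_cvg hl_cvg _ _ ulim).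
    by move=> e /usub[[]].
  by move=> e /usub; exact: subsolution_one_sided.
case: hJ => JE; rewrite JE in usub *.
  (* The contact point on [H] already contradicts the hypothesis on [u e]; if [H] is empty, nothing
     is to be checked. *)
  move=> phi _ x t Hx.
  by have := closed_time_absurd hOmega hn hT hml hC1 hC2 hC3 hb_cvg hl_cvg hC4 Hx usub.
exact: (tangential_limit hOmega hn hml hC1 hC2 hC3 hb_cvg hl_cvg hC4 usub ub ulim).
Qed.
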